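(* There exist an absolute constant $C>0$ and a bandit algorithm $\mathbb{A}$, which takes as input the time horizon $T$, the number of arms $K$ and the parameter $\rho$ (and has no knowledge of the reward distributions, means or gaps), such that for every integer $T\ge 2$, every integer $K\ge 1$ and every $\rho\in(0,1]$ the following hold. (i) $\mathbb{A}$ is $\rho$-replicable in the stochastic $K$-armed bandit setting with horizon $T$. (ii) For every choice of reward distributions of the $K$ arms, with gaps $(\Delta_j)_{j\in[K]}$, the expected regret satisfies $$\mathbf{E}[R_T]\le C\cdot\frac{K^2\log^2(T)}{\rho^2}\sum_{j:\Delta_j>0}\left(\Delta_j+\frac{\log(KT\log(T))}{\Delta_j}\right).$$ (iii) The running time of $\mathbb{A}$ is polynomial in $K$, $T$ and $1/\rho$.
   Context: Stochastic $K$-armed bandit: there is a set of arms $[K]=\{1,\dots,K\}$; each arm $a$ has a fixed unknown reward distribution $\mathcal{D}_a$ supported on $[0,1]$, with mean $\mu_a$. In each round $t=1,\dots,T$ the player pulls an arm $a_t$ and observes a reward $r_t\sim\mathcal{D}_{a_t}$, drawn independently of everything else. A bandit algorithm $\mathbb{A}$ chooses $a_t=\mathbb{A}(a_1,r_1,\dots,a_{t-1},r_{t-1};\xi)$ as a function of the past arm-reward pairs and of internal randomness $\xi$ (which is independent of the rewards). Gaps: $\Delta_j=\max_{a\in[K]}\mu_a-\mu_j$. Expected regret: $\mathbf{E}[R_T]=T\max_{a\in[K]}\mu_a-\mathbf{E}\left[\sum_{t=1}^T\mu_{a_t}\right]$. Replicability: for $\rho\in[0,1]$, $\mathbb{A}$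 is $\rho$-replicable if, for any reward distributions $(\mathcal{D}_a)_{a\in[K]}$ over $[0,1]$, and for two executions of $\mathbb{A}$ that share the same internal randomness $\xi$ but have independent reward realizations $r^{(1)},r^{(2)}$, $$\Pr_{\xi,r^{(1)},r^{(2)}}\left[(a_1^{(1)},\dots,a_T^{(1)})=(a_1^{(2)},\dots,a_T^{(2)})\right]\ge 1-\rho,$$ where $a_t^{(i)}$ is the arm pulled at round $t$ in execution $i$. $\log$ is the natural logarithm. Running time counts elementary operations (arithmetic operations and comparisons on real numbers, and draws of internal random numbers). *)

(* Defs.v *)
From HB Require Import structures.
From mathcomp Require Import all_boot all_order all_algebra.
From mathcomp Require Import all_classical all_reals all_analysis.

Set Implicit Arguments.
Unset Strict Implicit.
Unset Printing Implicit Defensive.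

Import Order.TTheory GRing.Theory Num.Theory.
Import numFieldNormedType.Exports.

Local Open Scope classical_set_scope.
Local Open Scope ring_scope.

(* Arms and rounds are numbered from 0.  The internal randomness [xi] is a
   sequence of numbers, later taken i.i.d. uniform on [0, 1].  The rewards of
   one execution are given by a table [r]: [r t a] is the reward that arm [a]
   returns if it is pulled in round [t]; the other entries of row [t] are never
   looked at. *)

Definition policy (R : realType) (K : nat) : Type :=
  (nat -> R) -> seq ('I_K * R) -> 'I_K.

Fixpoint history (R : realType) (K : nat) (A : policy R K)
    (xi : nat -> R) (r : nat -> 'I_K -> R) (t : nat) : seq ('I_K * R) :=
  if t is t'.+1 then
    let h := history A xi r t' in
    let a := A xi h in
    rcons h (a, r t' a)
  else [::].

Definition arm_at (R : realType) (K : nat) (A : policy R K)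
    (xi : nat -> R) (r : nat -> 'I_K -> R) (t : nat) : 'I_K :=
  A xi (history A xi r t).

Definition arms (R : realType) (K : nat) (A : policy R K)
    (xi : nat -> R) (r : nat -> 'I_K -> R) (T : nat) : seq 'I_K :=
  [seq arm_at A xi r t | t <- iota 0 T].

(* The arms pulled are random variables as soon as the internal random numbers
   and the rewards are. *)
Definition measurable_policy (R : realType) (K : nat) (A : policy R K) : Prop :=
  forall (d : measure_display) (Omega : measurableType d)
    (xi : nat -> Omega -> R) (r : nat -> 'I_K -> Omega -> R),
    (forall n, measurable_fun setT (xi n)) ->
    (forall t a, measurable_fun setT (r t a)) ->
    forall (t : nat) (a : 'I_K),
      measurable [set w | arm_at A (xi ^~ w) (fun s b => r s b w) t = a].

Record bandit_algorithm (R : realType) (K : nat) : Type := BanditAlgorithm {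
  policy_of :> policy R K;
  policy_measurable : measurable_policy policy_of
}.

Definition mutually_independent (R : realType) (d : measure_display)
    (Omega : measurableType d) (P : probability Omega R)
    (I : eqType) (Z : I -> Omega -> R) : Prop :=
  forall (s : seq I) (B : I -> set R), uniq s ->
    (forall i, measurable (B i)) ->
    P (\bigcap_(i in [set i | i \in s]) (Z i @^-1` B i)) =
    (\prod_(i <- s) P (Z i @^-1` B i))%E.

Definition reward_dists (R : realType) (K : nat) : Type :=
  'I_K -> probability (measurableTypeR R) R.

Definition supported01 (R : realType) (K : nat) (D : reward_dists R K) : Prop :=
  forall a, D a `[0, 1]%classic = 1%E.

(* The random inputs of [m] executions that share their internal randomness:
   [inl n] is the [n]-th internal random number, [inr (i, t, a)] is the entry
   [(t, a)] of the reward table of execution [i]. *)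
Definition input_index (m K : nat) : eqType := (nat + 'I_m * nat * 'I_K)%type.

Record bandit_inputs (R : realType) (d : measure_display)
    (Omega : measurableType d) (P : probability Omega R) (m K : nat)
    (D : reward_dists R K) (Z : input_index m K -> {RV P >-> R}) : Prop := {
  internal_uniform : forall (n : nat) (B : set R), measurable B ->
    distribution P (Z (inl n)) B = uniform_prob (@ltr01 R) B;
  reward_law : forall (i : 'I_m) (t : nat) (a : 'I_K) (B : set R),
    measurable B -> distribution P (Z (inr (i, t, a))) B = D a B;
  inputs_independent : mutually_independent P (fun i => Z i : Omega -> R)
}.

Definition xi_of (R : realType) (d : measure_display)
    (Omega : measurableType d) (P : probability Omega R) (m K : nat)
    (Z : input_index m K -> {RV P >-> R}) (w : Omega) : nat -> R :=
  fun n => Z (inl n) w.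

Definition rewards_of (R : realType) (d : measure_display)
    (Omega : measurableType d) (P : probability Omega R) (m K : nat)
    (Z : input_index m K -> {RV P >-> R}) (i : 'I_m) (w : Omega) :
    nat -> 'I_K -> R :=
  fun t a => Z (inr (i, t, a)) w.

Definition replicable (R : realType) (K : nat) (T : nat)
    (A : bandit_algorithm R K) (rho : R) : Prop :=
  forall D : reward_dists R K, supported01 D ->
  forall (d : measure_display) (Omega : measurableType d)
    (P : probability Omega R) (Z : input_index 2 K -> {RV P >-> R}),
    bandit_inputs D Z ->
    ((1 - rho)%:E <=
      P [set w | arms A (xi_of Z w) (rewards_of Z ord0 w) T =
                 arms A (xi_of Z w) (rewards_of Z ord_max w) T])%E.

Definition mean (R : realType) (K : nat) (D : reward_dists R K) (a : 'I_K) : R :=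
  fine (\int[D a]_x x%:E)%E.

Definition best_mean (R : realType) (k : nat) (D : reward_dists R k.+1) : R :=
  \big[Num.max/mean D ord0]_(a < k.+1) mean D a.

Definition gap (R : realType) (k : nat) (D : reward_dists R k.+1)
    (j : 'I_k.+1) : R :=
  best_mean D - mean D j.

Definition expected_regret (R : realType) (k : nat) (T : nat)
    (A : bandit_algorithm R k.+1) (D : reward_dists R k.+1)
    (d : measure_display) (Omega : measurableType d)
    (P : probability Omega R) (Z : input_index 1 k.+1 -> {RV P >-> R}) : \bar R :=
  ((T%:R * best_mean D)%:E -
   'E_P[fun w =>
     (\sum_(t < T) mean D (arm_at A (xi_of Z w) (rewards_of Z ord0 w) t))%R])%E.

(* Running time is measured on a real random-access machine.  Programs manipulate arrays of natural numbers and arrays of reals (a scalar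
   is the cell 0 of an array).  Reals support field operations and comparisons;
   there is no rounding from reals to naturals, and naturals (used as counters,
   addresses and names of arms) only have addition, truncated subtraction and
   comparison.  Every memory access, constant, operation, comparison, random
   draw, pull and control step costs one unit. *)

Inductive nexp : Type :=
| NConst (n : nat)
| NGet (x : nat) (i : nexp)
| NAdd (e1 e2 : nexp)
| NSub (e1 e2 : nexp).

Inductive rexp : Type :=
| ROfN (e : nexp)
| RGet (x : nat) (i : nexp)
| RAdd (e1 e2 : rexp)
| RSub (e1 e2 : rexp)
| RMul (e1 e2 : rexp)
| RDiv (e1 e2 : rexp).

Inductive bexp : Type :=
| NLe (e1 e2 : nexp)
| RLe (e1 e2 : rexp)
| BNot (b : bexp)
| BAnd (b1 b2 : bexp).

(* [CDraw x i] stores the next internal random number in cell [i] of the real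
   array [x]; [CPull x i e] pulls the arm numbered [e] and stores its reward
   there. *)
Inductive cmd : Type :=
| CSkip
| CNSet (x : nat) (i e : nexp)
| CRSet (x : nat) (i : nexp) (e : rexp)
| CDraw (x : nat) (i : nexp)
| CPull (x : nat) (i e : nexp)
| CSeq (c1 c2 : cmd)
| CIf (b : bexp) (c1 c2 : cmd)
| CWhile (b : bexp) (c : cmd).

Record state (R : realType) (K : nat) : Type := State {
  nmem : nat -> nat -> nat;
  rmem : nat -> nat -> R;
  draws : nat;
  trace : seq ('I_K * R)
}.

Definition upd (V : Type) (m : nat -> nat -> V) (x i : nat) (v : V) :
    nat -> nat -> V :=
  fun y j => if (y == x) && (j == i) then v else m y j.

Section Semantics.
Context (R : realType) (K : nat).

Fixpoint neval (s : state R K) (e : nexp) : nat :=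
  match e with
  | NConst n => n
  | NGet x i => nmem s x (neval s i)
  | NAdd e1 e2 => (neval s e1 + neval s e2)%N
  | NSub e1 e2 => (neval s e1 - neval s e2)%N
  end.

Fixpoint reval (s : state R K) (e : rexp) : R :=
  match e with
  | ROfN e => (neval s e)%:R
  | RGet x i => rmem s x (neval s i)
  | RAdd e1 e2 => reval s e1 + reval s e2
  | RSub e1 e2 => reval s e1 - reval s e2
  | RMul e1 e2 => reval s e1 * reval s e2
  | RDiv e1 e2 => reval s e1 / reval s e2
  end.

Fixpoint beval (s : state R K) (b : bexp) : bool :=
  match b with
  | NLe e1 e2 => (neval s e1 <= neval s e2)%N
  | RLe e1 e2 => reval s e1 <= reval s e2
  | BNot b => ~~ beval s b
  | BAnd b1 b2 => beval s b1 && beval s b2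
  end.

Fixpoint ncost (e : nexp) : nat :=
  match e with
  | NConst _ => 1
  | NGet _ i => (ncost i).+1
  | NAdd e1 e2 | NSub e1 e2 => (ncost e1 + ncost e2).+1
  end.

Fixpoint rcost (e : rexp) : nat :=
  match e with
  | ROfN e => (ncost e).+1
  | RGet _ i => (ncost i).+1
  | RAdd e1 e2 | RSub e1 e2 | RMul e1 e2 | RDiv e1 e2 =>
      (rcost e1 + rcost e2).+1
  end.

Fixpoint bcost (b : bexp) : nat :=
  match b with
  | NLe e1 e2 => (ncost e1 + ncost e2).+1
  | RLe e1 e2 => (rcost e1 + rcost e2).+1
  | BNot b => (bcost b).+1
  | BAnd b1 b2 => (bcost b1 + bcost b2).+1
  end.

Definition nset (s : state R K) (x i v : nat) : state R K :=
  State (upd (nmem s) x i v) (rmem s) (draws s) (trace s).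

Definition rset (s : state R K) (x i : nat) (v : R) : state R K :=
  State (nmem s) (upd (rmem s) x i v) (draws s) (trace s).

Definition draw (s : state R K) : state R K :=
  State (nmem s) (rmem s) (draws s).+1 (trace s).

Definition pull (s : state R K) (a : 'I_K) (v : R) : state R K :=
  State (nmem s) (rmem s) (draws s) (rcons (trace s) (a, v)).

(* [exec xi r c s n s']: started in [s], the program [c] halts in [s'] after
   [n] units of time.  A pull of a number that is not an arm gets stuck. *)
Inductive exec (xi : nat -> R) (r : nat -> 'I_K -> R) :
    cmd -> state R K -> nat -> state R K -> Prop :=
| ExecSkip s : exec xi r CSkip s 1 s
| ExecNSet x i e s :
    exec xi r (CNSet x i e) s (ncost i + ncost e).+1
      (nset s x (neval s i) (neval s e))
| ExecRSet x i e s :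
    exec xi r (CRSet x i e) s (ncost i + rcost e).+1
      (rset s x (neval s i) (reval s e))
| ExecDraw x i s :
    exec xi r (CDraw x i) s (ncost i).+1
      (rset (draw s) x (neval s i) (xi (draws s)))
| ExecPull x i e s (a : 'I_K) : neval s e = a ->
    exec xi r (CPull x i e) s (ncost i + ncost e).+1
      (rset (pull s a (r (size (trace s)) a))
            x (neval s i) (r (size (trace s)) a))
| ExecSeq c1 c2 s s1 s2 n1 n2 :
    exec xi r c1 s n1 s1 -> exec xi r c2 s1 n2 s2 ->
    exec xi r (CSeq c1 c2) s (n1 + n2).+1 s2
| ExecIf b c1 c2 s s' n :
    exec xi r (if beval s b then c1 else c2) s n s' ->
    exec xi r (CIf b c1 c2) s (bcost b + n).+1 s'
| ExecWhileF b c s : ~~ beval s b ->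
    exec xi r (CWhile b c) s (bcost b).+1 s
| ExecWhileT b c s s1 s2 n1 n2 : beval s b ->
    exec xi r c s n1 s1 -> exec xi r (CWhile b c) s1 n2 s2 ->
    exec xi r (CWhile b c) s (bcost b + n1 + n2).+1 s2.

(* The horizon and the number of arms are in cell 0 of the natural arrays 0 and
   1, the replicability parameter in cell 0 of the real array 0. *)
Definition init_state (T : nat) (rho : R) : state R K :=
  State (upd (upd (fun _ _ => 0%N) 0 0 T) 1 0 K)
        (upd (fun _ _ => 0) 0 0 rho) 0 [::].

End Semantics.

(* One program, the same for all inputs, plays the algorithm [A], in a number of
   steps which is bounded, on every realization of the rewards and of the
   internal randomness, by a polynomial in [K = k.+1], [T] and [1 / rho]. *)
Definition polynomial_time (R : realType)
    (A : forall (T k : nat) (rho : R), bandit_algorithm R k.+1) : Prop :=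
  exists (c : cmd) (a b : nat), forall (T k : nat) (rho : R),
    (2 <= T)%N -> 0 < rho <= 1 ->
    forall (xi : nat -> R) (r : nat -> 'I_k.+1 -> R),
      (forall n, 0 <= xi n <= 1) -> (forall t j, 0 <= r t j <= 1) ->
      exists (n : nat) (s : state R k.+1),
        [/\ exec xi r c (init_state k.+1 T rho) n s,
            trace s = history (A T k rho) xi r T
          & n%:R <= a%:R * (k.+1%:R + T%:R + rho^-1) ^+ b].

(* Main.v *)
(* Successive elimination in batches with one random threshold.  In batch [i]
   every live arm is pulled [quota i = n0 4^i] times in a row; then an arm is
   dropped if its reward sum is below the best one by more than
   [theta * width i], where [width i = n0 2^i] and [theta = 1 + xi 0] is uniform
   on [1, 2].  Blocks of pulls being contiguous, the reward sums are sums over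
   intervals of rounds of the reward table, so Hoeffding's inequality and a union
   bound over arms, batches and starting rounds control all of them at once,
   although the schedule is adaptive.  On this event the sums are within
   [width i / m] of their means and a best arm is never dropped, so that an arm
   is dropped iff its gap exceeds [theta 2^-i], except when [theta] falls in one
   of at most [K log T] windows of length [4 / m].  With [m] of order
   [K log T / rho] this has probability at most [rho / 4]; outside of it, two
   executions make the same decisions.  An arm of gap [g] is live only while
   [2^i g <= 6], hence is pulled [O(n0 / g^2)] times. *)

Require Import Defs.
From mathcomp Require Import all_boot all_order all_algebra.
From mathcomp Require Import all_classical all_reals all_analysis.
From mathcomp Require Import measurable_realfun ring lra zify.

Set Implicit Arguments.
Unset Strict Implicit.
Unset Printing Implicit Defensive.

Import Order.TTheory GRing.Theory Num.Theory.
Import numFieldNormedType.Exports.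

Local Open Scope classical_set_scope.
Local Open Scope ring_scope.

(** The growth rates are matched: the square of [width i] is [n0] times [quota i], so a deviation of
    [width i / m] has the tail exponent [n0 / (8 m^2)] in every batch. One value of [n0], of order
    [m^2 log (K T)], therefore serves all batches; it is the source of the factor
    [K^2 log^2 T / rho^2] in the regret. The obstacle to replicability is that both sides of an
    elimination test are empirical, the best sum included. The decisions of two executions are not
    compared directly: each agrees with the test on the true gaps, whose outcome does not depend on
    the rewards. The bad windows of [theta] are fixed by the gaps and the batch index, so a single
    draw serves all batches. Logarithms enter the algorithm as [trunc_log 2], which the machine
    computes by doubling; [ln] appears only in the final estimates. *)

Import HBNNSimple.

(** * Expectation of a product of functions of independent variables *)

Section independent_products.
Local Open Scope ereal_scope.
Context (R : realType) (d : measure_display) (Omega : measurableType d)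
  (P : probability Omega R).

(* [Y] stands for any factor independent of [X]; the hypothesis on indicators
   extends to [f] through simple functions. *)
Lemma integral_mul_comp (X : {RV P >-> R}) (Y : Omega -> R) (c : \bar R) :
  measurable_fun setT Y -> (forall w, (0 <= Y w)%R) ->
  c \is a fin_num -> 0 <= c ->
  (forall B : set R, measurable B ->
     \int[P]_w ((Y w)%:E * (\1_(X @^-1` B) w)%:E) = c * P (X @^-1` B)) ->
  forall f : R -> \bar R, measurable_fun setT f -> (forall x, 0 <= f x) ->
  \int[P]_w ((Y w)%:E * f (X w)) = c * \int[P]_w f (X w).
Proof.
move=> mY' Y0 cfin c0 YB f mf f0.
have mY : measurable_fun setT (fun w => (Y w)%:E) by exact/measurable_EFinP.
have mX : measurable_fun setT (X : Omega -> R) by exact: measurable_funPT.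
pose g := nnsfun_approx measurableT mf.
have g0 n x : (0 <= g n x)%R by [].
have mg n : measurable_fun setT (fun w => (g n (X w))%:E).
  by apply/measurable_EFinP; apply: measurableT_comp.
have gB n r : measurable (X @^-1` (g n @^-1` [set r])).
  by rewrite -[X in measurable X]setTI; apply: mX => //; exact: measurable_sfunP.
(* A negative [r] does no harm: the nonnegative [g n] never takes it as a value, so its indicator
   vanishes. *)
have gi0 n r w : 0 <= r%:E * (\1_(X @^-1` (g n @^-1` [set r])) w)%:E.
  have := nnfun_muleindic_ge0 (g n) r (X w).
  by congr (0 <= _ * _%:E); rewrite !indicE; congr (_%:R); apply/idP/idP; rewrite !inE.
have mi n r : measurable_fun setT
    (fun w => r%:E * (\1_(X @^-1` (g n @^-1` [set r])) w)%:E).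
  by apply: emeasurable_funM => //; apply/measurable_EFinP.
have gE n w : (g n (X w))%:E =
    \sum_(r \in range (g n)) (r%:E * (\1_(X @^-1` (g n @^-1` [set r])) w)%:E).
  rewrite (fimfunE (g n) (X w)) -fsumEFin//.
have intg n : \int[P]_w ((Y w)%:E * (g n (X w))%:E) = c * \int[P]_w (g n (X w))%:E.
  under eq_integral do rewrite gE ge0_mule_fsumr//.
  under [in RHS]eq_integral do rewrite gE.
  rewrite ge0_integral_fsum//; last 2 first.
    by move=> r; apply: emeasurable_funM.
    by move=> r w _; rewrite mule_ge0// lee_fin.
  rewrite ge0_integral_fsum//.
  rewrite ge0_mule_fsumr; last by move=> r; exact: integral_ge0.
  apply: eq_fsbigr => r; rewrite inE => -[x _ <-].
  under eq_integral do rewrite muleCA.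
  have gx0 : 0 <= (g n x)%:E by rewrite lee_fin.
  have mY1 : measurable_fun setT
      (fun w => (Y w)%:E * (\1_(X @^-1` (g n @^-1` [set g n x])) w)%:E).
    by apply: emeasurable_funM => //; apply/measurable_EFinP.
  have Y1 w : setT w ->
      0 <= (Y w)%:E * (\1_(X @^-1` (g n @^-1` [set g n x])) w)%:E.
    by rewrite mule_ge0// lee_fin.
  rewrite (ge0_integralZl P measurableT mY1 Y1 gx0).
  rewrite YB//.
  rewrite ge0_integralZl//; last exact/measurable_EFinP.
  by rewrite integral_indic// setIT muleCA.
have gcvg x : EFin \o g^~ x @ \oo --> f x by apply: cvg_nnsfun_approx.
have gnd x : {homo (fun n => (g n x)%:E) : n m / (n <= m)%N >-> n <= m}.
  move=> n m nm; rewrite lee_fin; have := nd_nnsfun_approx measurableT mf nm.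
  by move=> /lefP; apply.
have lim1 : \int[P]_w (g n (X w))%:E @[n --> \oo] --> \int[P]_w f (X w).
  rewrite (_ : \int[P]_w f (X w) = \int[P]_w limn (fun n => (g n (X w))%:E)).
    by apply: cvg_monotone_convergence => //= n w _; rewrite lee_fin.
  by apply: eq_integral => w _; apply/esym/cvg_lim => //; exact: gcvg.
have lim2 : \int[P]_w ((Y w)%:E * (g n (X w))%:E) @[n --> \oo] -->
    \int[P]_w ((Y w)%:E * f (X w)).
  rewrite (_ : \int[P]_w ((Y w)%:E * f (X w)) =
               \int[P]_w limn (fun n => (Y w)%:E * (g n (X w))%:E)).
    apply: cvg_monotone_convergence => //=.
    - by move=> n; apply: emeasurable_funM.
    - by move=> n w _; rewrite mule_ge0// lee_fin.
    - by move=> w _ n m nm; apply: lee_wpmul2l; [rewrite lee_fin|exact: gnd].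
  apply: eq_integral => w _; apply/esym/cvg_lim => //.
  by apply: cvgeZl => //; exact: gcvg.
(* Since [c] is finite, multiplication by it preserves limits, and the identity for simple functions
   passes to [f]. *)
have lim3 := cvgeZl cfin lim1.
rewrite -(funext intg) in lim3.
exact: cvg_unique lim2 lim3.
Qed.

(** Independence is defined on events only; the moment generating function of a block needs it for
    products of functions. *)
Lemma mutually_independent_integral_prod (I : eqType) (Z : I -> {RV P >-> R})
    (f : I -> R -> R) (s : seq I) :
  mutually_independent P (fun i => Z i : Omega -> R) -> uniq s ->
  (forall i, measurable_fun setT (f i)) -> (forall i x, (0 <= f i x)%R) ->
  (forall i, i \in s -> \int[P]_w (f i (Z i w))%:E \is a fin_num) ->
  \int[P]_w (\prod_(i <- s) f i (Z i w))%:E =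
  \prod_(i <- s) \int[P]_w (f i (Z i w))%:E.
Proof.
move=> indep us mf f0 ffin.
have mZ i : measurable_fun setT (Z i : Omega -> R) by exact: measurable_funPT.
have mfZ i : measurable_fun setT (fun w => f i (Z i w)).
  exact: measurableT_comp (mf i) (mZ i).
have mZB i B : measurable B -> measurable (Z i @^-1` B).
  by move=> mB; rewrite -[X in measurable X]setTI; exact: mZ.
pose cyl (s2 : seq I) (B : I -> set R) :=
  \bigcap_(i in [set i | i \in s2]) (Z i @^-1` B i).
have mcyl s2 B : (forall i, measurable (B i)) -> measurable (cyl s2 B).
  move=> mB; elim: s2 => [|j s2 IH].
    by rewrite (_ : cyl _ _ = setT)//; apply/seteqP; split=> // w _ i.
  rewrite (_ : cyl _ _ = Z j @^-1` B j `&` cyl s2 B).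
    by apply: measurableI => //; exact: mZB.
  apply/seteqP; split=> [w cw|w [wj cw] i /=].
    by split=> [|i is2]; apply: cw; rewrite /= in_cons ?eqxx// (is2 : i \in s2) orbT.
  by rewrite in_cons => /predU1P[->//|]; exact: cw.
have pf0 s1 : 0 <= \prod_(i <- s1) \int[P]_w (f i (Z i w))%:E.
  by apply: prode_ge0 => i _; apply: integral_ge0 => w _; rewrite lee_fin.
(* Indicators are replaced by the functions [f i], one index at a time. *)
suff main s1 s2 B : {subset s1 <= s} -> uniq (s1 ++ s2) ->
    (forall i, measurable (B i)) ->
    \int[P]_w (\prod_(i <- s1) f i (Z i w) * \1_(cyl s2 B) w)%:E =
    \prod_(i <- s1) \int[P]_w (f i (Z i w))%:E * P (cyl s2 B).
  have := main s [::] (fun=> setT); rewrite cats0 => /(_ (fun=> id) us (fun=> measurableT)).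
  have -> : cyl [::] (fun=> setT) = setT.
    by apply/seteqP; split=> // w _ i.
  rewrite probability_setT mule1 => <-.
  by apply: eq_integral => w _; rewrite indicE in_setT mulr1.
elim: s1 s2 B => [|i s1 IH] s2 B /= ss1 us12 mB.
  rewrite big_nil mul1e; under eq_integral do rewrite big_nil mul1r.
  by rewrite integral_indic ?setIT//; exact: mcyl.
have /andP[nis us'] := us12.
have ss1' : {subset s1 <= s} by move=> j js1; rewrite ss1// in_cons js1 orbT.
have nis2 : i \notin s2 by apply: contra nis; rewrite mem_cat => ->; rewrite orbT.
have us2 : uniq s2 by move: us'; rewrite cat_uniq => /and3P[].
set c := \prod_(j <- s1) \int[P]_w (f j (Z j w))%:E * P (cyl s2 B).
set Y := fun w => (\prod_(j <- s1) f j (Z j w) * \1_(cyl s2 B) w)%R.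
transitivity (\int[P]_w ((Y w)%:E * (f i (Z i w))%:E)).
  by apply: eq_integral => w _; rewrite big_cons -EFinM -mulrA mulrC.
have m1 (A : set Omega) : measurable A -> measurable_fun setT (\1_A : Omega -> R).
  by move=> mA; exact: measurable_indic.
(* An event on [Z i] is absorbed into the cylinder, so the induction hypothesis at [i :: s2] yields
   the identity on indicators that [integral_mul_comp] asks for. *)
have cyl_cons B0 : measurable B0 ->
    P (cyl s2 B `&` Z i @^-1` B0) = P (cyl s2 B) * P (Z i @^-1` B0) /\
    \int[P]_w ((Y w)%:E * (\1_(Z i @^-1` B0) w)%:E) =
    \prod_(j <- s1) \int[P]_w (f j (Z j w))%:E * P (cyl s2 B `&` Z i @^-1` B0).
  move=> mB0; pose B' j := if j == i then B0 else B j.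
  have mB' j : measurable (B' j) by rewrite /B'; case: ifP.
  have B's2 j : j \in s2 -> B' j = B j.
    by rewrite /B'; case: eqP => // ->; rewrite (negbTE nis2).
  have cylE : cyl (i :: s2) B' = cyl s2 B `&` Z i @^-1` B0.
    apply/seteqP; split=> [w cw|w [cw wB0] j].
      split=> [j js2|]; last by have := cw i (mem_head _ _); rewrite /= /B' eqxx.
      have := cw j; rewrite /= in_cons js2 orbT => /(_ isT).
      by rewrite B's2.
    rewrite /= in_cons; have [-> _|_ /= js2] := eqVneq j i.
      by rewrite /B' eqxx.
    by rewrite B's2//; exact: cw.
  split.
    rewrite -cylE /cyl (indep (i :: s2) B')//=; last by rewrite nis2.
    rewrite (indep s2 B)// big_cons {1}/B' eqxx muleC; congr (_ * _).
    by apply: eq_big_seq => j js2; rewrite B's2.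
  rewrite -cylE -(IH (i :: s2) B')//; last first.
    by rewrite uniq_catC /= mem_cat orbC -mem_cat nis uniq_catC.
  apply: eq_integral => w _; rewrite cylE -EFinM /Y -mulrA; congr (_ * _)%:E.
  by rewrite indicI.
rewrite [LHS](@integral_mul_comp (Z i) Y c _ _ _ _ _ (EFin \o f i)).
- by rewrite big_cons /c muleC muleA.
- apply: measurable_funM; last exact/m1/mcyl.
  by apply: measurable_prod.
- by move=> w; rewrite mulr_ge0 ?prodr_ge0// => j _.
- rewrite fin_numM ?fin_num_measure//; last exact: mcyl.
  by rewrite big_seq; apply: prode_fin_num => j js1; exact/ffin/ss1'.
- by rewrite mule_ge0.
- move=> B0 mB0; have [e ->] := cyl_cons B0 mB0.
  by rewrite e muleA.
- exact/measurable_EFinP.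
- by move=> x; rewrite lee_fin.
Qed.
End independent_products.

(** * Mean and moment generating function of a law on [0, 1] *)

Section bounded_law.
Context (R : realType) (D : probability (measurableTypeR R) R)
  (D01 : D `[0, 1]%classic = 1%E).

(** Boundedness holds only almost surely under [D]. Clipping changes no integral and makes the
    bounds hold everywhere. *)
Let clip (x : R) : R := Num.max 0 (Num.min x 1).
Let mu : R := fine (\int[D]_x x%:E)%E.

Let clip_itv x : 0 <= clip x <= 1.
Proof. by rewrite /clip le_max lexx ge_max ler01 ge_min lexx orbT. Qed.

Let measurable_clip : measurable_fun setT clip.
Proof.
by apply: measurable_maxr => //; apply: measurable_minr.
Qed.

Let integral_clip (f : R -> R) : measurable_fun setT f ->
  (\int[D]_x (f x)%:E)%E = (\int[D]_x (f (clip x))%:E)%E.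
Proof.
move=> mf; apply: ae_eq_integral => //.
- exact/measurable_EFinP.
- by apply/measurable_EFinP; exact: measurableT_comp.
exists (~` `[0, 1]); split.
- exact: measurableC.
- by rewrite [LHS]probability_setC// D01 subee.
move=> x /= nfx x01; apply: nfx => _; congr (f _)%:E.
by move: x01; rewrite in_itv/= /clip => /andP[x0 x1]; rewrite min_l// max_r.
Qed.

Let integrable_bounded (f : R -> R) M : measurable_fun setT f ->
  (forall x, `|f x| <= M) -> D.-integrable setT (EFin \o f).
Proof.
move=> mf fM; apply: measurable_bounded_integrable => //.
  by rewrite [ltLHS]probability_setT ltry.
by exists M; split=> [|y My x _]; first exact: num_real; exact: le_trans (fM x) (ltW My).
Qed.

Let integrable_clip : D.-integrable setT (EFin \o clip).
Proof.
apply: (@integrable_bounded _ 1) => // x.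
by have /andP[? ?] := clip_itv x; rewrite ger0_norm.
Qed.

Let mean_clip : (\int[D]_x (clip x)%:E)%E = mu%:E.
Proof.
rewrite /mu (integral_clip (@measurable_id _ _ _)) fineK//.
exact: (integrable_fin_num measurableT integrable_clip).
Qed.

Lemma bounded_law_mean : 0 <= mu <= 1.
Proof.
rewrite -!lee_fin -mean_clip integral_ge0/=; last first.
  by move=> x _; rewrite lee_fin; case/andP: (clip_itv x).
apply: (@le_trans _ _ (\int[D]_x 1%:E)%E).
  apply: ge0_le_integral => //.
  - by move=> x _; rewrite lee_fin; case/andP: (clip_itv x).
  - exact/measurable_EFinP.
  - by move=> x _; rewrite lee_fin; case/andP: (clip_itv x).
by rewrite integral_cst// [X in (_ * X)%E]probability_setT mule1.
Qed.

(** From [exp (-y) >= 1 - y] one gets [exp y <= 1 / (1 - y)], and [(1 + y + 2 y^2) (1 - y) = 1 + y^2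
    (1 - 2 y) >= 1]. *)
Lemma expR_le_quadratic (y : R) : y <= 2^-1 -> expR y <= 1 + y + 2 * y ^+ 2.
Proof.
move=> y12; have y1 : 0 < 1 - y by lra.
have : expR y <= (1 - y)^-1.
  rewrite -[expR y]invrK -expRN lef_pV2 ?posrE ?expR_gt0//.
  by have := expR_ge1Dx (- y).
move/le_trans; apply; rewrite -div1r ler_pdivrMr//.
have : 0 <= y ^+ 2 * (1 - 2 * y) by rewrite mulr_ge0 ?sqr_ge0//; lra.
by nra.
Qed.

(** A form of Hoeffding's lemma with a worse constant and an elementary proof: in the quadratic
    bound on [exp], the linear term has mean 0 and the square is at most 1, which leaves
    [1 + 2 l^2 <= exp (2 l^2)]. *)
Lemma bounded_law_mgf (l : R) : `|l| <= 2^-1 ->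
  (\int[D]_x (expR (l * (x - mu)))%:E <= (expR (2 * l ^+ 2))%:E)%E.
Proof.
move=> l12; have /andP[mu0 mu1] := bounded_law_mean.
have mexp : measurable_fun setT (fun x : R => expR (l * (x - mu))).
  apply: measurableT_comp => //; apply: measurable_funM => //.
  exact: measurable_funB.
have lxm x : `|l * (clip x - mu)| <= 2^-1.
  rewrite normrM -[2^-1]mulr1 ler_pM//.
  by have /andP[? ?] := clip_itv x; rewrite ler_norml; lra.
rewrite integral_clip//.
(* This is [1 + l (x - mu) + 2 l^2], regrouped as a constant plus a multiple of [clip x]. *)
apply: (@le_trans _ _ (\int[D]_x ((1 - l * mu + 2 * l ^+ 2) + l * clip x)%:E)%E).
  apply: le_integral => //.
  - apply: (@integrable_bounded (fun x => expR (l * (clip x - mu))) (expR 2^-1)).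
      exact: measurableT_comp mexp measurable_clip.
    move=> x; rewrite ger0_norm ?expR_ge0// ler_expR.
    exact: le_trans (ler_norm _) (lxm x).
  - apply: (@integrable_bounded _ (`|1 - l * mu + 2 * l ^+ 2| + `|l|)).
      by apply: measurable_funD => //; apply: measurable_funM.
    move=> x; rewrite (le_trans (ler_normD _ _))// lerD2l normrM ler_piMr//.
    by have /andP[? ?] := clip_itv x; rewrite ger0_norm.
  - move=> x _; rewrite lee_fin.
    have := expR_le_quadratic (le_trans (ler_norm _) (lxm x)); move/le_trans; apply.
    have : (clip x - mu) ^+ 2 <= 1.
      by have /andP[? ?] := clip_itv x; nra.
    by have := sqr_ge0 l; rewrite exprMn; nra.
under eq_integral do rewrite EFinD EFinM.
rewrite integralD//; last 2 first.
  exact: finite_measure_integrable_cst.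
  exact: integrableZl.
rewrite integral_cst// [X in (_ * X + _)%E]probability_setT mule1 integralZl// mean_clip.
rewrite -EFinM -EFinD lee_fin (le_trans _ (expR_ge1Dx _))//.
by lra.
Qed.

End bounded_law.

(* [measurableTypeR R] and [R] have the same measurable sets but different
   displays, hence the pushforward along the identity. *)
Lemma integral_law (R : realType) (d : measure_display)
    (Omega : measurableType d) (P : probability Omega R) (X : {RV P >-> R})
    (D : probability (measurableTypeR R) R) (f : R -> R) :
  (forall B : set R, measurable B -> distribution P X B = D B) ->
  measurable_fun setT f -> (forall x, 0 <= f x) ->
  (\int[distribution P X]_x (f x)%:E = \int[D]_x (f x)%:E)%E.
Proof.
move=> XD mf f0.
have mid : measurable_fun setT (id : measurableTypeR R -> R).
  by move=> _ B mB; rewrite setTI.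
pose D' := [the measure _ _ of pushforward D (id : measurableTypeR R -> R)].
transitivity (\int[D' mid]_x (f x)%:E)%E.
  by apply: eq_measure_integral => B mB _; exact: XD.
rewrite ge0_integral_pushforward//; first exact/measurable_EFinP.
by move=> x; rewrite lee_fin.
Qed.

(** * Concentration of the reward sum over a block of rounds *)

Section block_concentration.
Context (R : realType) (d : measure_display) (Omega : measurableType d)
  (P : probability Omega R) (m K : nat) (D : reward_dists R K)
  (Z : input_index m K -> {RV P >-> R}).
Hypotheses (D01 : supported01 D) (DZ : bandit_inputs D Z).

Definition block_dev (r : nat -> 'I_K -> R) (a : 'I_K) (s n : nat) : R :=
  \sum_(s <= u < s + n) r u a - n%:R * mean D a.

Lemma block_devE r a s n :
  block_dev r a s n = \sum_(s <= u < s + n) (r u a - mean D a).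
Proof.
rewrite /block_dev sumrB; congr (_ - _).
by rewrite sumr_const_nat addKn mulr_natl.
Qed.

Lemma measurable_block_dev i a s n :
  measurable_fun setT (fun w => block_dev (rewards_of Z i w) a s n).
Proof.
apply: measurable_funB => //; apply: measurable_sum => u.
exact: measurable_funPT.
Qed.

Lemma block_dev_mgf i a s n (l : R) : `|l| <= 2^-1 ->
  (\int[P]_w (expR (l * block_dev (rewards_of Z i w) a s n))%:E <=
   (expR (2 * l ^+ 2 *+ n))%:E)%E.
Proof.
move=> l12; pose f (x : R) := expR (l * (x - mean D a)).
pose js : seq (input_index m K) := [seq inr (i, u, a) | u <- index_iota s (s + n)].
have mf : measurable_fun setT f.
  apply: measurableT_comp => //; apply: measurable_funM => //.
  exact: measurable_funB.
have fint j : j \in js ->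
    ((0 <= \int[P]_w (f (Z j w))%:E) &&
     (\int[P]_w (f (Z j w))%:E <= (expR (2 * l ^+ 2))%:E))%E.
  move=> /mapP[u _ ->]; apply/andP; split.
    by apply: integral_ge0 => w _; rewrite lee_fin expR_ge0.
  have -> : (\int[P]_w (f (Z (inr (i, u, a)) w))%:E = \int[D a]_x (f x)%:E)%E.
    transitivity (\int[distribution P (Z (inr (i, u, a)))]_x (f x)%:E)%E.
      rewrite ge0_integral_distribution//; first exact/measurable_EFinP.
      by move=> x; rewrite lee_fin expR_ge0.
    by apply: integral_law => // [B mB|x]; [exact: (reward_law DZ)|exact: expR_ge0].
  exact: bounded_law_mgf.
have -> : (\int[P]_w (expR (l * block_dev (rewards_of Z i w) a s n))%:E =
    \int[P]_w (\prod_(j <- js) f (Z j w))%:E)%E.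
  apply: eq_integral => w _; rewrite block_devE mulr_sumr expR_sum big_map.
  by [].
rewrite (@mutually_independent_integral_prod _ _ _ P _ Z (fun=> f))//.
- rewrite -[2 * _ *+ n]mulr_natl expRM_natl EFin_expe.
  have -> : n = size js by rewrite size_map size_iota addKn.
  elim: js fint => [|j js IH] fint; first by rewrite big_nil expe0.
  rewrite big_cons expeS; have /andP[j0 j1] := fint j (mem_head _ _).
  apply: lee_pmul => //; last by apply: IH => k kjs; rewrite fint// in_cons kjs orbT.
  rewrite big_seq; apply: prode_ge0 => k kjs.
  by case/andP: (fint k (@mem_behead _ (j :: js) k kjs)).
- exact: inputs_independent DZ.
- by rewrite map_inj_uniq ?iota_uniq// => u v [].
- by move=> _ x; rewrite expR_ge0.
- move=> j /fint /andP[j0 j1]; rewrite ge0_fin_numE//.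
  exact: le_lt_trans j1 (ltry _).
Qed.

(** Chernoff's method with [l = x / (4 n)], which minimizes [2 l^2 n - l x]; the condition
    [x <= 2 n] says precisely that [l <= 1/2]. The sign [e] treats both tails at once. *)
Lemma block_dev_tail i a s n (x : R) : (0 < n)%N -> 0 <= x <= 2 * n%:R ->
  (P [set w | (x < `|block_dev (rewards_of Z i w) a s n|)%R] <=
   (2 * expR (- (x ^+ 2 / (8 * n%:R))))%:E)%E.
Proof.
move=> n0 /andP[x0 x2n]; have n0' : 0 < n%:R :> R by rewrite ltr0n.
set S := fun w => block_dev (rewards_of Z i w) a s n.
have mS : measurable_fun setT S by exact: measurable_block_dev.
pose A (e : R) := [set w | x < e * S w].
have mA e : measurable (A e).
  rewrite -[A e]setTI; apply: measurable_fun_ltr => //.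
  exact: measurable_funM.
suff tail e : e = 1 \/ e = -1 ->
    (P (A e) <= (expR (- (x ^+ 2 / (8 * n%:R))))%:E)%E.
  apply: (@le_trans _ _ (P (A 1 `|` A (-1)))).
    apply: le_measure; rewrite ?inE.
    - rewrite -[X in measurable X]setTI; apply: measurable_fun_ltr => //.
      exact: measurableT_comp.
    - exact: measurableU.
    - move=> w /=; rewrite /A /= mul1r mulN1r ltr_normr.
      by move=> /orP[]; [left|right].
  apply: le_trans (measureU2 _ _ _) _ => //.
  by rewrite mulr_natl mulr2n EFinD leeD// tail//; [left|right].
move=> e1; pose l := e * (x / (4 * n%:R)).
have x4n : 0 <= x / (4 * n%:R) by rewrite divr_ge0// mulr_ge0// ltW.
have ne : `|e| = 1 by case: e1 => ->; rewrite ?normrN normr1.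
have l12 : `|l| <= 2^-1.
  rewrite normrM ne mul1r ger0_norm// ler_pdivrMr ?mulr_gt0//.
  by rewrite mulrA (_ : 2^-1 * 4 = 2) //; field.
have [mono mexp] : (forall w, A e w -> expR (x / (4 * n%:R) * x) <= expR (l * S w)) /\
    measurable_fun setT (fun w => expR (l * S w)).
  split; last by apply: measurableT_comp => //; exact: measurable_funM.
  move=> w /ltW Aw; rewrite ler_expR.
  have -> : l * S w = x / (4 * n%:R) * (e * S w) by rewrite /l; ring.
  exact: ler_wpM2l.
have : ((expR (x / (4 * n%:R) * x))%:E * P (A e) <=
    (expR (2 * l ^+ 2 *+ n))%:E)%E.
  apply: le_trans (block_dev_mgf i a s n l12).
  have m1 : measurable_fun setT (fun w => (\1_(A e) w : R)%:E).
    exact/measurable_EFinP/measurable_indic.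
  have p1 w : setT w -> (0 <= (\1_(A e) w : R)%:E)%E by rewrite lee_fin.
  rewrite -[A e]setIT -integral_indic//.
  rewrite -(ge0_integralZl_EFin P measurableT p1 m1 (expR_ge0 _)).
  apply: ge0_le_integral => //.
  - by apply: emeasurable_funM => //; exact/measurable_EFinP/measurable_indic.
  - exact/measurable_EFinP.
  move=> w _; rewrite -EFinM lee_fin indicE.
  have [|_] := boolP (w \in A e); last by rewrite mulr0 expR_ge0.
  by rewrite inE mulr1; exact: mono.
rewrite -lee_pdivlMl ?expR_gt0// -EFinM -expRN -expRD => /le_trans; apply.
rewrite lee_fin ler_expR -mulr_natr /l exprMn.
have -> : e ^+ 2 = 1 by case: e1 => ->; rewrite ?sqrrN expr1n.
by rewrite le_eqVlt; apply/orP; left; apply/eqP; field; rewrite gt_eqF.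
Qed.
End block_concentration.

(** * The algorithm *)

Section elimination.
Context (R : realType) (k : nat).

(** [pos] is the position in [live] of the arm being pulled, [cnt] the number of its pulls in the
    current batch and [acc] their reward sum. [sums] is indexed by positions, not by arms; its
    entries from [pos] on are stale. *)
Record elim_state : Type := ElimState {
  live : seq 'I_k.+1;
  pos : nat;
  cnt : nat;
  batch : nat;
  acc : R;
  best : R;
  sums : nat -> R
}.

Definition elim_init : elim_state :=
  ElimState (enum 'I_k.+1) 0 0 0 0 0 (fun=> 0).

Definition elim_choose (st : elim_state) : 'I_k.+1 := nth ord0 (live st) (pos st).

Definition survivors (thr : R) (L : seq 'I_k.+1) (b : R) (F : nat -> R) :=
  [seq nth ord0 L q | q <- iota 0 (size L) & b - F q <= thr].

(* [best] is reset to 0 at the end of a batch, which is not the maximum of an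
   empty list of sums; hence the test on the position. *)
Definition new_best (p : nat) (b x : R) : R :=
  if p is 0 then x else Num.max b x.

Definition new_sums (F : nat -> R) (p : nat) (x : R) : nat -> R :=
  fun q => if q == p then x else F q.

Variables (n0 : nat).

Definition quota (i : nat) : nat := n0 * 4 ^ i.

Definition width (i : nat) : R := (n0 * 2 ^ i)%N%:R.

(** The bookkeeping at the end of an arm or of a batch belongs to the step of the last pull, so that
    every state designates an arm to pull. *)
Definition elim_step (theta : R) (st : elim_state) (x : R) : elim_state :=
  let: ElimState L p c i a b F := st in
  let a' := a + x in
  if (c.+1 < quota i)%N then ElimState L p c.+1 i a' b F
  else
    let b' := new_best p b a' in
    let F' := new_sums F p a' in
    if (p.+1 < size L)%N then ElimState L p.+1 0 i 0 b' F'
    else ElimState (survivors (theta * width i) L b' F') 0 0 i.+1 0 0 F'.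

(** A policy is a function of the history, so its state is recomputed from it. Reading the rewards
    is enough: with [theta] they determine the arms. *)
Definition elim_run (theta : R) (h : seq ('I_k.+1 * R)) : elim_state :=
  foldl (fun st x => elim_step theta st x.2) elim_init h.

Definition elim_policy : policy R k.+1 :=
  fun xi h => elim_choose (elim_run (1 + xi 0%N) h).

Definition elim_at (xi : nat -> R) (r : nat -> 'I_k.+1 -> R) (t : nat) :=
  elim_run (1 + xi 0%N) (history elim_policy xi r t).

Lemma elim_atS xi r t :
  elim_at xi r t.+1 =
  elim_step (1 + xi 0%N) (elim_at xi r t) (r t (elim_choose (elim_at xi r t))).
Proof. by rewrite /elim_at /= /elim_run foldl_rcons. Qed.

Lemma arm_at_elim xi r t : arm_at elim_policy xi r t = elim_choose (elim_at xi r t).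
Proof. by []. Qed.

End elimination.

(** * Measurability of functions with countably many values *)

Section discrete_measurability.
Context (d : measure_display) (Omega : measurableType d).

(** On a countable type this is measurability for the discrete sigma-algebra. *)
Definition fiber_measurable (X : countType) (f : Omega -> X) : Prop :=
  forall x, measurable (f @^-1` [set x]).

Lemma fiber_measurable_preimage (X : countType) (f : Omega -> X) (Q : set X) :
  fiber_measurable f -> measurable (f @^-1` Q).
Proof.
move=> mf.
rewrite (_ : f @^-1` Q =
    \bigcup_x (if `[< Q x >] then f @^-1` [set x] else set0)); last first.
  apply/seteqP; split=> [w Qw|w [x _]]; first by exists (f w) => //; case: asboolP.
  by case: asboolP => // Qx /= ->.
by apply: countable_bigcupT_measurable => // x; case: ifP => // _; exact: mf.
Qed.

Lemma fiber_measurable_cst (X : countType) (x : X) : fiber_measurable (cst x).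
Proof. by move=> y; rewrite preimage_cst; case: ifP. Qed.

Lemma fiber_measurable_comp (X Y : countType) (h : X -> Y) (f : Omega -> X) :
  fiber_measurable f -> fiber_measurable (h \o f).
Proof. by move=> mf y; rewrite comp_preimage; exact: fiber_measurable_preimage. Qed.

(** The space is cut into the countably many fibers of [f], on each of which the first argument of
    [g] is frozen. A branching computation is thus reduced to its branches. *)
Lemma fiber_measurable_case (X Y : countType) (f : Omega -> X)
    (g : X -> Omega -> Y) :
  fiber_measurable f -> (forall x, fiber_measurable (g x)) ->
  fiber_measurable (fun w => g (f w) w).
Proof.
move=> mf mg y.
rewrite (_ : _ @^-1` _ =
    \bigcup_(x in setT) (f @^-1` [set x] `&` g x @^-1` [set y])); last first.
  by apply/seteqP; split=> [w <-|w [x _ [/= <-//]]]; exists (f w).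
by apply: countable_bigcupT_measurable => // x; apply: measurableI; [exact: mf|exact: mg].
Qed.

Lemma measurable_fun_case (R : realType) (X : countType) (f : Omega -> X)
    (g : X -> Omega -> R) :
  fiber_measurable f -> (forall x, measurable_fun setT (g x)) ->
  measurable_fun setT (fun w => g (f w) w).
Proof.
move=> mf mg _ B mB; rewrite setTI.
rewrite (_ : _ @^-1` _ =
    \bigcup_(x in setT) (f @^-1` [set x] `&` g x @^-1` B)); last first.
  by apply/seteqP; split=> [w Bw|w [x _ [/= <-//]]]; exists (f w).
apply: countable_bigcupT_measurable => // x; apply: measurableI; first exact: mf.
by rewrite -[X in measurable X]setTI; exact: mg.
Qed.

Lemma fiber_measurable_le (R : realType) (u v : Omega -> R) :
  measurable_fun setT u -> measurable_fun setT v ->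
  fiber_measurable (fun w => u w <= v w).
Proof.
move=> mu mv b.
have m : measurable [set w | u w <= v w].
  by rewrite -[X in measurable X]setTI; exact: measurable_fun_le.
case: b => //.
rewrite (_ : _ @^-1` _ = ~` [set w | u w <= v w]); first exact: measurableC.
by apply/seteqP; split=> w /=; [move=> -> |move/negP/negbTE].
Qed.

Lemma fiber_measurable_filter (I : Type) (Y : countType) (h : I -> Y) (s : seq I)
    (b : I -> Omega -> bool) :
  (forall q, fiber_measurable (b q)) ->
  fiber_measurable (fun w => [seq h q | q <- s & b q w]).
Proof.
move=> mb; elim: s => [|q s IH]; first exact: fiber_measurable_cst.
rewrite (_ : (fun w => _) = fun w => (if b q w then cons (h q) else id)
    [seq h q | q <- s & b q w]); last by apply/funext => w /=; case: (b q w).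
apply: (@fiber_measurable_case _ _ (b q) (fun e w => (if e then cons (h q) else id)
    [seq h q | q <- s & b q w])) => // e.
exact: (@fiber_measurable_comp _ _ (if e then cons (h q) else id)).
Qed.
End discrete_measurability.

(** * Measurability of the elimination policy *)

Section policy_measurability.
Context (R : realType) (k n0 : nat).
Context (d : measure_display) (Omega : measurableType d).

(** These components take countably many values and determine the arm to pull; the two executions
    are later compared on them. *)
Definition discrete_part (st : elim_state R k) : seq 'I_k.+1 * nat * nat * nat :=
  (live st, pos st, cnt st, batch st).

Definition measurable_state (st : Omega -> elim_state R k) : Prop :=
  [/\ fiber_measurable (fun w => discrete_part (st w)),
      measurable_fun setT (fun w => acc (st w)),
      measurable_fun setT (fun w => best (st w))
    & forall q, measurable_fun setT (fun w => sums (st w) q)].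

Lemma measurable_state_step (theta : Omega -> R) (st : Omega -> elim_state R k)
    (x : 'I_k.+1 -> Omega -> R) :
  measurable_fun setT theta -> (forall a, measurable_fun setT (x a)) ->
  measurable_state st ->
  measurable_state
    (fun w => elim_step n0 (theta w) (st w) (x (elim_choose (st w)) w)).
Proof.
move=> mth mx [md ma mb mF].
(* In [stp y] the discrete components are frozen at [y], so every branch of [elim_step] is decided
   and only the survivor test still depends on the outcome. *)
pose mk (y : seq 'I_k.+1 * nat * nat * nat) w := ElimState y.1.1.1 y.1.1.2 y.1.2
  y.2 (acc (st w)) (best (st w)) (sums (st w)).
pose stp y w := elim_step n0 (theta w) (mk y w) (x (elim_choose (mk y w)) w).
have stE w : elim_step n0 (theta w) (st w) (x (elim_choose (st w)) w) =
    stp (discrete_part (st w)) w by rewrite /stp /mk; case: (st w).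
suff mstp y : measurable_state (stp y).
  split=> [||| q].
  - under eq_fun do rewrite stE.
    by apply: (fiber_measurable_case (g := fun y w => discrete_part (stp y w)) md) => y;
      case: (mstp y).
  - under eq_fun do rewrite stE.
    by apply: (measurable_fun_case (g := fun y w => acc (stp y w)) md) => y;
      case: (mstp y).
  - under eq_fun do rewrite stE.
    by apply: (measurable_fun_case (g := fun y w => best (stp y w)) md) => y;
      case: (mstp y).
  - under eq_fun do rewrite stE.
    by apply: (measurable_fun_case (g := fun y w => sums (stp y w) q) md) => y;
      case: (mstp y).
case: y => [[[L p] c] i]; rewrite /stp /mk /elim_choose /=.
set a := nth _ _ _.
have max' : measurable_fun setT (fun w => acc (st w) + x a w).
  exact: measurable_funD.
have mbest : measurable_fun setT (fun w => new_best p (best (st w)) (acc (st w) + x a w)).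
  by case: (p) => [|p'] //; exact: measurable_maxr.
have msums q : measurable_fun setT
    (fun w => new_sums (sums (st w)) p (acc (st w) + x a w) q).
  by rewrite /new_sums; case: eqP.
case: (c.+1 < quota n0 i)%N; first by split=> //; rewrite /discrete_part /=; exact: fiber_measurable_cst.
case: (p.+1 < size L)%N; first by split=> //; rewrite /discrete_part /=; exact: fiber_measurable_cst.
split=> //; rewrite /discrete_part /=.
apply: (@fiber_measurable_comp _ _ _ _ (fun L => (L, 0, 0, i.+1)%N)).
apply: fiber_measurable_filter => q; apply: fiber_measurable_le.
  by apply: measurable_funB.
by apply: measurable_funM.
Qed.

Lemma measurable_state_at (xi : nat -> Omega -> R)
    (r : nat -> 'I_k.+1 -> Omega -> R) t :
  measurable_fun setT (xi 0%N) -> (forall t a, measurable_fun setT (r t a)) ->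
  measurable_state (fun w => elim_at n0 (xi ^~ w) (fun s b => r s b w) t).
Proof.
move=> mxi mr; elim: t => [|t IH].
  split; first exact: (fiber_measurable_cst Omega (discrete_part (elim_init R k))).
  - exact: measurable_cst.
  - exact: measurable_cst.
  - by move=> q; exact: measurable_cst.
under eq_fun do rewrite elim_atS.
apply: measurable_state_step => //.
exact: measurable_funD.
Qed.

End policy_measurability.

Lemma measurable_elim_policy (R : realType) (k n0 : nat) :
  measurable_policy (@elim_policy R k n0).
Proof.
move=> d Omega xi r mxi mr t a.
have [md _ _ _] := measurable_state_at n0 t (mxi 0%N) mr.
exact: (fiber_measurable_preimage
  [set y | nth ord0 y.1.1.1 y.1.1.2 = a] md).
Qed.

(** * Invariant of a run, valid for every reward table *)

Section elimination_run.
Context (R : realType) (k n0 : nat) (n0_gt0 : (0 < n0)%N).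
Implicit Types (r : nat -> 'I_k.+1 -> R) (st : elim_state R k).

Definition block_sum r (a : 'I_k.+1) (u n : nat) : R := \sum_(u <= v < u + n) r v a.

(** The starting round [u] is existentially quantified: all that is remembered of the adaptive
    schedule is that the block ends by round [t], which is what a union bound over starting rounds
    can use. Nothing is claimed of [b] when [p = 0], where it is a mere default. *)
Definition finished_inv r (t : nat) (L : seq 'I_k.+1) (n p : nat) (b : R)
    (F : nat -> R) : Prop :=
  (forall q, (q < p)%N -> exists u,
     (u + n <= t)%N /\ F q = block_sum r (nth ord0 L q) u n) /\
  ((0 < p)%N -> (forall q, (q < p)%N -> F q <= b) /\
     exists q, (q < p)%N /\ b = F q).

Definition run_inv r t st : Prop :=
  [/\ uniq (live st), (pos st < size (live st))%N,
      (cnt st < quota n0 (batch st))%N,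
      (cnt st <= t)%N /\
        acc st = block_sum r (elim_choose st) (t - cnt st) (cnt st)
    & finished_inv r t (live st) (quota n0 (batch st)) (pos st) (best st) (sums st)].

(** The discrete effect of a step is kept and the new real components are left free, except at the
    end of a batch, where [finished_inv] is what the survivor test is analyzed with. *)
Variant step_spec (theta : R) r (t : nat) st : elim_state R k -> Prop :=
| StepPull x of ((cnt st).+1 < quota n0 (batch st))%N :
    step_spec theta r t st
      (ElimState (live st) (pos st) (cnt st).+1 (batch st) x (best st) (sums st))
| StepArm b F of (cnt st).+1 = quota n0 (batch st)
    & ((pos st).+1 < size (live st))%N :
    step_spec theta r t st (ElimState (live st) (pos st).+1 0 (batch st) 0 b F)
| StepBatch b F of (cnt st).+1 = quota n0 (batch st)
    & (pos st).+1 = size (live st)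
    & finished_inv r t.+1 (live st) (quota n0 (batch st)) (size (live st)) b F :
    step_spec theta r t st
      (ElimState (survivors (theta * width R n0 (batch st)) (live st) b F)
         0 0 (batch st).+1 0 0 F).

Lemma quota_gt0 i : (0 < quota n0 i)%N.
Proof. by rewrite muln_gt0 n0_gt0 expn_gt0. Qed.

Lemma finished_inv_step r t L n p b F x :
  finished_inv r t L n p b F ->
  (exists u, (u + n <= t.+1)%N /\ x = block_sum r (nth ord0 L p) u n) ->
  finished_inv r t.+1 L n p.+1 (new_best p b x) (new_sums F p x).
Proof.
move=> [sF bF] xE; split=> [q|_].
  rewrite ltnS leq_eqVlt /new_sums => /predU1P[->|qp]; first by rewrite eqxx.
  rewrite (ltn_eqF qp); have [u [ut Fq]] := sF _ qp.
  by exists u; split=> //; exact: leqW.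
case: p sF bF xE => [|p] sF bF xE.
  by split=> [[|q]//|]; exists 0%N.
have [Fb [q [qp bE]]] := bF isT.
have newF q' : (q' < p.+1)%N -> new_sums F p.+1 x q' = F q'.
  by move=> q'p; rewrite /new_sums ltn_eqF.
split=> [q'|].
  rewrite ltnS leq_eqVlt => /predU1P[->|q'p].
    by rewrite /new_sums eqxx /= le_max lexx orbT.
  by rewrite newF// /= le_max Fb.
have [xb|bx] := leP x b.
  by exists q; split; [exact: ltnW|rewrite newF//= bE max_l// -bE].
exists p.+1; split=> //=; rewrite /new_sums eqxx max_r//; exact: ltW.
Qed.

Lemma survivors_uniq thr (L : seq 'I_k.+1) b (F : nat -> R) :
  uniq L -> uniq (survivors thr L b F).
Proof.
move=> uL; rewrite map_inj_in_uniq ?filter_uniq ?iota_uniq//.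
move=> q q'; rewrite !mem_filter !mem_iota !add0n => /andP[_ qL] /andP[_ q'L].
by move=> /eqP; rewrite nth_uniq// => /eqP.
Qed.

Lemma survivorsP thr (L : seq 'I_k.+1) b (F : nat -> R) a :
  reflect (exists q, [/\ (q < size L)%N, nth ord0 L q = a & b - F q <= thr])
    (a \in survivors thr L b F).
Proof.
apply: (iffP mapP) => [[q]|[q [qL <- bq]]].
  by rewrite mem_filter mem_iota add0n => /and3P[? ? ?] ->; exists q.
by exists q => //; rewrite mem_filter mem_iota add0n bq qL.
Qed.

Lemma run_inv_step (theta : R) r t st : 0 <= theta -> run_inv r t st ->
  let st' := elim_step n0 theta st (r t (elim_choose st)) in
  run_inv r t.+1 st' /\ step_spec theta r t st st'.
Proof.
move=> th0 [].
case: st => L p c i a b F; rewrite /elim_choose /= => uL pL cn [ct aE] fin.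
set arm := nth ord0 L p in aE *; set n := quota n0 i in cn fin *.
have a'E : a + r t arm = block_sum r arm (t - c) c.+1.
  by rewrite aE /block_sum addnS big_nat_recr ?leq_addr//= subnK.
case: ifP => [c1n|/negbT]; last rewrite -leqNgt => nc.
  split; last exact: (@StepPull theta r t (ElimState L p c i a b F)).
  split=> //=.
  case: fin => sF bF; split=> // q /sF[u [ut Fq]].
  by exists u; split=> //; exact: leqW.
have c1n : c.+1 = n by apply/eqP; rewrite eqn_leq cn nc.
have fin' : finished_inv r t.+1 L n p.+1 (new_best p b (a + r t arm))
    (new_sums F p (a + r t arm)).
  (* The block just finished consists of the rounds from [t - c] to [t] inclusive. *)
  apply: finished_inv_step => //; exists (t - c)%N.
  by rewrite -c1n addnS subnK// a'E.
case: ifP => [p1L|/negbT]; last rewrite -leqNgt => Lp.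
  split; last by apply: (@StepArm theta r t (ElimState L p c i a b F)).
  split=> //=; first exact: quota_gt0.
  by rewrite subn0 /block_sum addn0 big_geq.
have p1L : p.+1 = size L by apply/eqP; rewrite eqn_leq pL Lp.
rewrite p1L in fin'.
split; last by apply: (@StepBatch theta r t (ElimState L p c i a b F)).
split=> //=.
- exact: survivors_uniq.
(* The position attaining the best sum passes the test because the threshold is nonnegative, so the
   live list never becomes empty. *)
- have [_ /(_ (leq_ltn_trans (leq0n p) pL)) [_ [q [qL bq]]]] := fin'.
  rewrite lt0n size_eq0; apply/eqP => s0.
  have : nth ord0 L q \in survivors (theta * width R n0 i) L
      (new_best p b (a + r t arm)) (new_sums F p (a + r t arm)).
    by apply/survivorsP; exists q; split=> //; rewrite bq subrr mulr_ge0// ler0n.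
  by rewrite s0.
- exact: quota_gt0.
- by rewrite subn0 /block_sum addn0 big_geq.
Qed.

(** No good event is assumed, because the program must not get stuck on any realization. *)
Lemma run_inv_at xi r t : 0 <= 1 + xi 0%N -> run_inv r t (elim_at n0 xi r t).
Proof.
move=> th0; elim: t => [|t IH]; last first.
  by rewrite elim_atS; case: (run_inv_step th0 IH).
split=> //=.
- exact: enum_uniq.
- by rewrite size_enum_ord.
- exact: quota_gt0.
- by rewrite /block_sum addn0 big_geq.
Qed.

End elimination_run.

(** * Elementary facts on gaps *)

Section gaps.
Context (R : realType) (k : nat) (D : reward_dists R k.+1).

Lemma gap_ge0 j : 0 <= gap D j.
Proof. by rewrite subr_ge0; exact: le_bigmax. Qed.

Lemma gap_eq0_ex : exists j, gap D j = 0.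
Proof.
suff [j jE] : exists j, mean D j = best_mean D by exists j; rewrite /gap jE subrr.
rewrite /best_mean; elim/big_ind: _ => [|x y [i <-] [j <-]|j _]; first by exists ord0.
  by case: leP => _; [exists j|exists i].
by exists j.
Qed.

Lemma gap_le1 j : supported01 D -> gap D j <= 1.
Proof.
move=> D01; have mb a : 0 <= mean D a <= 1 by exact: bounded_law_mean.
rewrite /gap lerBlDr (le_trans (_ : _ <= 1))//; last first.
  by rewrite lerDl; case/andP: (mb j).
by apply/bigmax_leP; split=> [|a _]; case/andP: (mb ord0) => //; case/andP: (mb a).
Qed.

End gaps.

(** * Elimination when all block sums are close to their means *)

Section good_rewards.
Context (R : realType) (k n0 T : nat) (n0_gt0 : (0 < n0)%N).
Context (D : reward_dists R k.+1) (D01 : supported01 D) (eta : R).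
Hypothesis eta_itv : 0 <= eta <= 2^-1.
Implicit Types (xi : nat -> R) (r : nat -> 'I_k.+1 -> R) (st : elim_state R k).

Definition good r : Prop := forall a i s, (s + quota n0 i <= T)%N ->
  `|block_dev D r a s (quota n0 i)| <= eta * width R n0 i.

(** Origin of the 6: surviving batch [i] forces [quota i * gap <= (theta + 2 eta) * width i <= 3 *
    width i], that is [2^i * gap <= 3], and the batch number then increases by one. *)
Definition live_inv st : Prop :=
  (exists j, j \in live st /\ gap D j = 0) /\
  forall a, a \in live st -> 2 ^+ batch st * gap D a <= 6.

Lemma quotaE i : (quota n0 i)%:R = 2 ^+ i * width R n0 i :> R.
Proof.
by rewrite /width -natrX -natrM mulnCA -expnMn.
Qed.

Lemma width_gt0 i : 0 < width R n0 i.
Proof. by rewrite ltr0n muln_gt0 n0_gt0 expn_gt0. Qed.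

(** The best sum [b] may belong to a suboptimal arm. It is at least the sum of an optimal live arm,
    and at most the optimal expectation plus one deviation since gaps are nonnegative; the second
    deviation is that of [F q]. *)
Lemma finished_dev r t L i b F q : good r -> (t <= T)%N ->
  finished_inv r t L (quota n0 i) (size L) b F ->
  (exists j, j \in L /\ gap D j = 0) -> (q < size L)%N ->
  `|b - F q - (quota n0 i)%:R * gap D (nth ord0 L q)| <= 2 * eta * width R n0 i.
Proof.
move=> gr tT [sF bF] [j [jL j0]] qL.
have [Fb [q' [q'L bE]]] := bF (leq_ltn_trans (leq0n _) qL).
have dev q1 : (q1 < size L)%N ->
    `|F q1 - (quota n0 i)%:R * mean D (nth ord0 L q1)| <= eta * width R n0 i.
  move=> /sF[u [ut ->]]; apply: gr.
  exact: leq_trans ut tT.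
have gapE a : mean D a = best_mean D - gap D a by rewrite /gap subKr.
have bj : F (index j L) <= b by apply: Fb; rewrite index_mem.
have := dev _ qL; have := dev _ q'L.
have : (index j L < size L)%N by rewrite index_mem.
move=> /dev; rewrite nth_index// !gapE j0 -bE.
have := mulr_ge0 (ler0n R (quota n0 i)) (gap_ge0 D (nth ord0 L q')).
move: bj; set w := eta * _.
have -> : 2 * eta * width R n0 i = 2 * w by rewrite /w mulrA.
rewrite !ler_norml !mulrBr.
move=> h1 h2 /andP[h3 h4] /andP[h5 h6] /andP[h7 h8]; apply/andP; split; lra.
Qed.

Lemma live_inv_step theta r t st : 1 <= theta <= 2 -> good r -> (t < T)%N ->
  run_inv n0 r t st -> live_inv st ->
  live_inv (elim_step n0 theta st (r t (elim_choose st))).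
Proof.
move=> /andP[th1 th2] gr tT inv [star act].
have [_ []] := run_inv_step n0_gt0 (le_trans ler01 th1) inv => //= b F.
set n := quota n0 _; set w := width R n0 _ => _ _ fin.
have w0 : 0 < w by exact: width_gt0.
have nE : n%:R = 2 ^+ batch st * w by exact: quotaE.
have /andP[eta0 eta1] := eta_itv.
have etaw : 2 * eta * w <= w by rewrite ler_piMl ?(ltW w0)//; lra.
have thw : w <= theta * w <= 2 * w by rewrite ler_peMl ?(ltW w0)//= ler_wpM2r ?(ltW w0).
(* An optimal arm lags behind the best sum by at most [2 eta w <= w <= theta w]; hence the
   requirements [eta <= 1/2] and [theta >= 1]. *)
split=> /= [|a /survivorsP[q [qL <- bq]]].
  have [j [jL j0]] := star; exists j; split=> //; apply/survivorsP.
  exists (index j (live st)); rewrite index_mem; split=> //; first exact: nth_index.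
  have jL' : (index j (live st) < size (live st))%N by rewrite index_mem.
  have := finished_dev gr tT fin star jL'.
  rewrite nth_index// j0 mulr0 subr0 ler_norml => /andP[_ h].
  by rewrite (le_trans h)// (le_trans etaw)//; case/andP: thw.
have := finished_dev gr tT fin star qL.
rewrite -/n -/w nE ler_norml => /andP[h _].
have h2 : 2 ^+ batch st * gap D (nth ord0 (live st) q) <= 3.
  rewrite -(ler_pM2r w0); move: h bq thw; rewrite mulrAC => h bq /andP[_ thw].
  lra.
by rewrite exprS -mulrA; lra.
Qed.

Lemma live_inv_at xi r t : 0 <= xi 0%N <= 1 -> good r -> (t <= T)%N ->
  live_inv (elim_at n0 xi r t).
Proof.
move=> /andP[xi0 xi1] gr; elim: t => [_|t IH tT].
  split=> [|a _] /=.
    have [j j0] := gap_eq0_ex D.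
    by exists j; rewrite mem_enum.
  by rewrite expr0 mul1r (le_trans (gap_le1 _ D01))// ler1n.
rewrite elim_atS; apply: live_inv_step => //; last exact: IH (ltnW tT).
  by apply/andP; split; lra.
by apply: run_inv_at => //; lra.
Qed.

Definition pulls xi r (j : 'I_k.+1) (t : nat) : nat :=
  (\sum_(u < t) (arm_at (elim_policy n0) xi r u == j))%N.

(* An arm that is not live has [index j (live st) = size (live st)], so that the
   value is 0. *)
Definition pulls_in_batch st (j : 'I_k.+1) : nat :=
  let q := index j (live st) in
  if (q < pos st)%N then quota n0 (batch st)
  else if q == pos st then cnt st else 0.

(** A completed batch is charged a full quota as soon as its index allows [j] to be live, whether or
    not [j] was; the current batch is counted exactly, as the induction on rounds requires. *)
Lemma pulls_le xi r j t : 0 <= xi 0%N <= 1 -> good r -> (t <= T)%N ->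
  let st := elim_at n0 xi r t in
  (pulls xi r j t <=
   \sum_(i < batch st | (2 ^+ i * gap D j <= 6 :> R)%R) quota n0 i +
   pulls_in_batch st j)%N.
Proof.
move=> xi01 gr; have /andP[xi0 xi1] := xi01.
have th0 : 0 <= 1 + xi 0%N by lra.
elim: t => [_|t IH tT] /=; first by rewrite /pulls big_ord0.
have := IH (ltnW tT) => {}IH.
rewrite /pulls big_ord_recr /= -/(pulls _ _ _ _).
apply: leq_trans (leq_add IH (leqnn _)) _.
have inv := run_inv_at n0_gt0 r t th0.
have [_ act] := live_inv_at xi01 gr (ltnW tT).
rewrite elim_atS arm_at_elim.
have [uL pL cn _ _] := inv.
move: act uL pL cn; have [_] := run_inv_step n0_gt0 th0 inv.
set st := elim_at n0 xi r t; set st' := elim_step _ _ _ _ => stst' act uL pL cn.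
have chE : (elim_choose st == j) = (index j (live st) == pos st).
  apply/eqP/eqP => [<-|jp]; first by rewrite index_uniq.
  by rewrite /elim_choose -jp nth_index// -index_mem jp.
have idx : j \notin live st -> (pos st < index j (live st))%N.
  by move=> /memNindex ->.
case: stst' => [x c1|b F c1 p1|b F c1 p1 fin]; rewrite /pulls_in_batch /= chE.
- by rewrite -addnA leq_add2l; case: ltngtP; rewrite ?addn0 ?addn1.
- rewrite -addnA leq_add2l ltnS; case: ltngtP; rewrite ?addn0 ?addn1 ?c1//.
- have -> : (\sum_(i < (batch st).+1 | (2 ^+ i * gap D j <= 6 :> R)%R) quota n0 i =
      \sum_(i < batch st | (2 ^+ i * gap D j <= 6 :> R)%R) quota n0 i +
      if (2 ^+ batch st * gap D j <= 6 :> R)%R then quota n0 (batch st) else 0)%N.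
    by rewrite big_mkcond big_ord_recr /= -big_mkcond.
  rewrite ?ltn0 if_same addn0 -!addnA leq_add2l.
  have [/act ->|/idx pj] := boolP (j \in live st).
    by case: ltngtP; rewrite ?addn0 ?addn1 ?c1.
  by case: ltngtP pj.
Qed.

(** A geometric sum is dominated by its last term, for which [4^i g^2 <= 36]. The earlier terms add
    at most a third of that, whence [48 = 36 + 12]; the second conjunct in the proof supplies this
    third. *)
Lemma quota_sum_le (g : R) I : 0 <= g ->
  (\sum_(i < I | (2 ^+ i * g <= 6 :> R)%R) quota n0 i)%:R * g ^+ 2 <= 48 * n0%:R.
Proof.
move=> g0; have n00 := ler0n R n0.
suff [] : (\sum_(i < I | (2 ^+ i * g <= 6 :> R)%R) quota n0 i)%:R * g ^+ 2 <= 48 * n0%:R /\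
  (3 * (\sum_(i < I | (2 ^+ i * g <= 6 :> R)%R) quota n0 i)%:R <= n0%:R * (4 ^+ I - 1) :> R) by [].
elim: I => [|I [IH1 IH2]].
  by rewrite big_ord0 expr0 subrr !mulr0 mul0r; split=> //; rewrite mulr_ge0.
rewrite big_mkcond big_ord_recr /= -big_mkcond /= natrD.
set s := (\sum_(i < I | _) _)%:R in IH1 IH2 *.
have pow : 4 ^+ I = (2 ^+ I) ^+ 2 :> R by rewrite -exprM mulnC exprM; congr (_ ^+ _); ring.
have p4 : 0 <= (2 ^+ I : R) by rewrite exprn_ge0.
have n04 := mulr_ge0 n00 (sqr_ge0 (2 ^+ I : R)).
case: ifP => [cond|_]; last first.
  by rewrite addr0; split=> //; rewrite (le_trans IH2)// exprS pow; nra.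
have qE : (quota n0 I)%:R = n0%:R * 4 ^+ I :> R by rewrite natrM natrX.
rewrite qE; split; last by rewrite exprS; nra.
have c36 : 4 ^+ I * g ^+ 2 <= 36.
  by rewrite pow -exprMn; have := mulr_ge0 p4 g0; nra.
have s' : 3 * s <= n0%:R * 4 ^+ I by rewrite (le_trans IH2)//; lra.
have : 3 * (s * g ^+ 2) <= n0%:R * (4 ^+ I * g ^+ 2).
  by have := ler_wpM2r (sqr_ge0 g) s'; rewrite -!mulrA.
have : n0%:R * (4 ^+ I * g ^+ 2) <= n0%:R * 36 by rewrite ler_wpM2l.
by rewrite mulrDl; lra.
Qed.

Lemma pulls_gap_le xi r j : 0 <= xi 0%N <= 1 -> good r ->
  (pulls xi r j T)%:R * gap D j ^+ 2 <= 48 * n0%:R.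
Proof.
move=> xi01 gr; have /andP[xi0 xi1] := xi01.
(* The unfinished batch is charged as if it were complete, hence the successor. *)
apply: le_trans (quota_sum_le (batch (elim_at n0 xi r T)).+1 (gap_ge0 D j)).
rewrite ler_wpM2r ?sqr_ge0// ler_nat.
apply: leq_trans (pulls_le j xi01 gr (leqnn T)) _.
have th0 : 0 <= 1 + xi 0%N by lra.
have [_ _ cn _ _] := run_inv_at n0_gt0 r T th0.
have [_ act] := live_inv_at xi01 gr (leqnn T).
have [uL pL _ _ _] := run_inv_at n0_gt0 r T th0.
set st := elim_at n0 xi r T in cn act uL pL *.
rewrite big_mkcond [X in (_ <= X)%N]big_mkcond big_ord_recr /= leq_add2l.
rewrite /pulls_in_batch; have [/act ->|/memNindex ->] := boolP (j \in live st).
  by case: ltngtP => // _; exact: ltnW.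
by case: ltngtP pL.
Qed.

End good_rewards.

(** * Two executions with the same threshold *)

Section lockstep.
Context (R : realType) (k n0 T : nat) (n0_gt0 : (0 < n0)%N).
Context (D : reward_dists R k.+1) (D01 : supported01 D) (eta : R).
Hypothesis eta_itv : 0 <= eta <= 2^-1.
Implicit Types (xi : nat -> R) (r : nat -> 'I_k.+1 -> R) (st : elim_state R k).

(** Only batches with [quota n0 i <= T] can end within the horizon; this keeps the number of windows
    for [theta] logarithmic in [T]. *)
Definition thresholds_separated (theta : R) : Prop := forall a i, (quota n0 i <= T)%N ->
  2 * eta * width R n0 i < `|(quota n0 i)%:R * gap D a - theta * width R n0 i|.

(** The margin exceeds the error in [finished_dev], so the empirical test and the test on the gaps
    agree. The right-hand side no longer mentions rewards. *)
Lemma survivors_separated (theta : R) r t st b F :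
  good n0 T D eta r -> thresholds_separated theta -> (t < T)%N -> run_inv n0 r t st ->
  live_inv D st -> (cnt st).+1 = quota n0 (batch st) ->
  finished_inv r t.+1 (live st) (quota n0 (batch st)) (size (live st)) b F ->
  survivors (theta * width R n0 (batch st)) (live st) b F =
  [seq nth ord0 (live st) q | q <- iota 0 (size (live st)) &
     (quota n0 (batch st))%:R * gap D (nth ord0 (live st) q) <=
     theta * width R n0 (batch st)].
Proof.
move=> gr sep tT [_ _ _ [ct _] _] [star _] c1 fin.
rewrite /survivors; congr map; apply: eq_in_filter => q.
rewrite mem_iota add0n => /= qL.
have qT : (quota n0 (batch st) <= T)%N by rewrite -c1; exact: leq_ltn_trans ct tT.
have := finished_dev gr tT fin star qL.
have := sep (nth ord0 (live st) q) _ qT.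
rewrite ltr_normr ler_norml => h /andP[h1 h2].
by apply/idP/idP => h3; move: h => /orP[] h; lra.
Qed.

Lemma lockstep xi r1 r2 t : 0 <= xi 0%N <= 1 ->
  good n0 T D eta r1 -> good n0 T D eta r2 -> thresholds_separated (1 + xi 0%N) ->
  (t <= T)%N ->
  discrete_part (elim_at n0 xi r1 t) = discrete_part (elim_at n0 xi r2 t).
Proof.
move=> xi01 g1 g2 sep; have /andP[xi0 xi1] := xi01.
have th0 : 0 <= 1 + xi 0%N by lra.
elim: t => [//|t IH tT].
have := IH (ltnW tT) => {}IH.
have inv1 := run_inv_at n0_gt0 r1 t th0.
have inv2 := run_inv_at n0_gt0 r2 t th0.
have l1 := live_inv_at n0_gt0 D01 eta_itv xi01 g1 (ltnW tT).
have l2 := live_inv_at n0_gt0 D01 eta_itv xi01 g2 (ltnW tT).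
rewrite !elim_atS.
have [_ s1] := run_inv_step n0_gt0 th0 inv1.
have [_ s2] := run_inv_step n0_gt0 th0 inv2.
have c1 := survivors_separated g1 sep tT inv1 l1.
have c2 := survivors_separated g2 sep tT inv2 l2.
case: IH => eL ep ec eb.
case: s1 => [x1 a1|b1 F1 a1 d1|b1 F1 a1 d1 f1]; case: s2 => [x2 a2|b2 F2 a2 d2|b2 F2 a2 d2 f2];
  rewrite /discrete_part /=; rewrite ?eL ?ep ?ec ?eb//.
(* Mixed cases are impossible: the kind of step is decided by the counters and the live list, on
   which the executions agree. *)
all: try by move: a1 a2; rewrite ?ec ?eb => a1 a2; move: a1 a2 => //; lia.
all: try by move: d1 d2; rewrite ?ep ?eL; lia.
rewrite -eb -eL (c1 _ _ a1 f1) eL eb -eL; rewrite eL.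
by rewrite (c2 _ _ a2 f2).
Qed.

Lemma lockstep_arms xi r1 r2 : 0 <= xi 0%N <= 1 ->
  good n0 T D eta r1 -> good n0 T D eta r2 -> thresholds_separated (1 + xi 0%N) ->
  arms (elim_policy n0) xi r1 T = arms (elim_policy n0) xi r2 T.
Proof.
move=> xi01 g1 g2 sep; apply/eq_in_map => t; rewrite mem_iota add0n => /= tT.
rewrite !arm_at_elim /elim_choose.
by have [-> ->] := lockstep xi01 g1 g2 sep (ltnW tT).
Qed.
End lockstep.

(** * Probability of the bad events *)

Section bad_events.
Context (R : realType) (d : measure_display) (Omega : measurableType d)
  (P : probability Omega R).

Lemma measure_bigsetU_le (I : Type) (s : seq I) (F : I -> set Omega) (c : R) :
  (forall x, measurable (F x)) -> (forall x, (P (F x) <= c%:E)%E) ->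
  (P (\big[setU/set0]_(x <- s) F x) <= ((size s)%:R * c)%:E)%E.
Proof.
move=> mF Fc; elim: s => [|x s IH]; first by rewrite big_nil measure0 mul0r.
rewrite big_cons; apply: le_trans (measureU2 _ _ _) _ => //.
  exact: bigsetU_measurable.
by rewrite -natr1 mulrDl mul1r addrC EFinD leeD//; exact: Fc.
Qed.

Context (m k n0 T : nat) (n0_gt0 : (0 < n0)%N) (D : reward_dists R k.+1)
  (Z : input_index m k.+1 -> {RV P >-> R}).
Context (eta : R).

(** The batch index ranges crudely below [T], which suffices as [i < 4^i <= quota n0 i]. The tail
    bound easily absorbs [K T^2] events. *)
Definition bad_rewards (i : 'I_m) : set Omega :=
  \big[setU/set0]_(x : 'I_k.+1 * 'I_T * 'I_T)
    [set w | (x.1.2 + quota n0 x.2 <= T)%N /\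
       eta * width R n0 x.2 <
       `|block_dev D (rewards_of Z i w) x.1.1 x.1.2 (quota n0 x.2)|].

(** Here the number of events matters, since [resolution] is proportional to it; hence the
    logarithmic range of batches. *)
Definition bad_theta : set Omega :=
  \big[setU/set0]_(x : 'I_k.+1 * 'I_(trunc_log 2 T).+1)
    [set w | `|(quota n0 x.2)%:R * gap D x.1 - (1 + xi_of Z w 0) * width R n0 x.2|
       <= 2 * eta * width R n0 x.2].

(** The internal number is uniform only in law, whereas the analysis of a run is pointwise; this
    null event is the difference. *)
Definition bad_range : set Omega := xi_of Z ^~ 0%N @^-1` ~` `[0, 1].

Lemma measurable_xi0 : measurable_fun setT (fun w => xi_of Z w 0).
Proof. exact: measurable_funPT. Qed.

Lemma measurable_bad_rewards_aux i (x : 'I_k.+1 * 'I_T * 'I_T) : measurable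
  [set w | (x.1.2 + quota n0 x.2 <= T)%N /\
       eta * width R n0 x.2 <
       `|block_dev D (rewards_of Z i w) x.1.1 x.1.2 (quota n0 x.2)|].
Proof.
case: (x.1.2 + quota n0 x.2 <= T)%N; last first.
  by rewrite (_ : [set w | _] = set0)//; apply/seteqP; split=> // w [].
rewrite -[X in measurable X]setTI (_ : setT `&` _ = setT `&` [set w | eta * width R n0 x.2 <
       `|block_dev D (rewards_of Z i w) x.1.1 x.1.2 (quota n0 x.2)|]); last first.
  by apply/seteqP; split=> w [? ] // [].
apply: measurable_fun_ltr => //.
by apply: measurableT_comp => //; exact: measurable_block_dev.
Qed.

Lemma measurable_bad_rewards i : measurable (bad_rewards i).
Proof. by apply: bigsetU_measurable => x _; exact: measurable_bad_rewards_aux. Qed.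

Lemma measurable_bad_theta_aux (x : 'I_k.+1 * 'I_(trunc_log 2 T).+1) : measurable
    [set w | `|(quota n0 x.2)%:R * gap D x.1 - (1 + xi_of Z w 0) * width R n0 x.2|
       <= 2 * eta * width R n0 x.2].
Proof.
rewrite -[X in measurable X]setTI; apply: measurable_fun_le => //.
apply: measurableT_comp => //; apply: measurable_funB => //.
by apply: measurable_funM => //; apply: measurable_funD => //; exact: measurable_xi0.
Qed.

Lemma measurable_bad_theta : measurable bad_theta.
Proof. by apply: bigsetU_measurable => x _; exact: measurable_bad_theta_aux. Qed.

Lemma measurable_bad_range : measurable bad_range.
Proof.
rewrite -[X in measurable X]setTI; apply: measurable_xi0 => //.
exact: measurableC.
Qed.

Lemma good_not_bad i w : (~ bad_rewards i w) -> good n0 T D eta (rewards_of Z i w).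
Proof.
move=> nb a j s sT; rewrite leNgt; apply/negP => h; apply: nb.
have jT : (j < T)%N.
  apply: leq_trans (_ : quota n0 j <= T)%N; last by lia.
  apply: leq_trans (ltn_expl j (isT : 1 < 4)%N) _.
  by rewrite leq_pmull.
have sT' : (s < T)%N by have := quota_gt0 n0_gt0 j; lia.
rewrite /bad_rewards (bigD1 (a, Ordinal sT', Ordinal jT))//=.
by left.
Qed.

Lemma separated_not_bad w : ~ bad_theta w -> thresholds_separated n0 T D eta (1 + xi_of Z w 0).
Proof.
move=> nb a j jT; rewrite ltNge; apply/negP => h; apply: nb.
have j' : (j < (trunc_log 2 T).+1)%N.
  rewrite ltnS; apply: trunc_log_max => //; apply: leq_trans jT.
  rewrite (@leq_trans (4 ^ j))//; first by rewrite -[4%N]/(2 * 2)%N expnMn leq_pmull ?expn_gt0.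
  by rewrite leq_pmull.
rewrite /bad_theta (bigD1 (a, Ordinal j'))//=.
by left.
Qed.
End bad_events.

(** * Uniform law on [0, 1] *)

Section uniform_law.
Context (R : realType).

Lemma uniform_prob_itv_le (a b : R) : a <= b ->
  (uniform_prob (@ltr01 R) `[a, b]%classic <= (b - a)%:E)%E.
Proof.
move=> ab; rewrite /uniform_prob.
apply: (@le_trans _ _ (\int[lebesgue_measure]_(x in `[a, b]) 1%:E)%E).
  apply: ge0_le_integral => //.
  - by move=> x _; rewrite lee_fin uniform_pdf_ge0.
  - apply/measurable_EFinP/measurable_funTS; exact: measurable_uniform_pdf.
  - move=> x _; rewrite lee_fin /uniform_pdf subr0 invr1.
    by case: ifP.
rewrite integral_cst//= lebesgue_measure_itv/= lte_fin mul1e.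
by case: ltP => // _; rewrite lee_fin subr_ge0.
Qed.

Lemma uniform_prob_compl01 : uniform_prob (@ltr01 R) (~` `[0, 1])%classic = 0%E.
Proof.
rewrite probability_setC//.
by rewrite [X in (1 - X)%E]integral_uniform_pdf1// subee.
Qed.

End uniform_law.

(** * Choice of the parameters and union bounds *)

Section parameters.
Context (R : realType) (k T : nat) (rho : R).
Hypotheses (T2 : (2 <= T)%N) (rho01 : 0 < rho <= 1).

Definition log_horizon : nat := (trunc_log 2 T).+1.
Definition log_pulls : nat := (trunc_log 2 (k.+1 * T)).+1.
(** This is the [m] of the overview. With the factor 16, [K * log_horizon] windows of length
    [4 / resolution] have total length [rho / 4]. *)
Definition resolution : R := 16 * k.+1%:R * log_horizon%:R / rho.
(** Here [48 = 8 * 6]: the tail exponent [n0 / (8 m^2)] becomes at least [6 * log_pulls]. *)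
Definition quota_bound : R := 48 * resolution ^+ 2 * log_pulls%:R.
Definition base_quota : nat := (Num.truncn quota_bound).+1.

Lemma resolution_ge16 : 16 <= resolution.
Proof.
have /andP[r0 r1] := rho01.
rewrite /resolution ler_pdivlMr// (le_trans (_ : _ <= 16 * 1))//.
  by rewrite ler_wpM2l.
by rewrite -mulrA ler_wpM2l// -natrM ler1n muln_gt0.
Qed.

Lemma resolution_gt0 : 0 < resolution.
Proof. exact: lt_le_trans resolution_ge16. Qed.

Lemma quota_bound_lt : quota_bound < base_quota%:R.
Proof. exact: truncnS_gt. Qed.

Lemma quota_bound_ge : resolution ^+ 2 <= quota_bound.
Proof.
rewrite /quota_bound -mulrA mulrCA ler_peMr ?sqr_ge0// -natrM ler1n.
by rewrite muln_gt0.
Qed.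

Lemma eta_itv : 0 <= resolution^-1 <= 2^-1.
Proof.
have m16 := resolution_ge16; have m0 := resolution_gt0.
by rewrite invr_ge0 (ltW m0) lef_pV2 ?posrE//; lra.
Qed.

Lemma expR1_ge2 : 2 <= expR 1 :> R.
Proof. by have := expR_ge1Dx (1 : R). Qed.

(** The index [j] cancels because [width j] squared is [n0] times [quota j]; then [exp 1 >= 2] turns
    the binary logarithm [log_pulls] into a power of [K T]. *)
Lemma tail_le j :
  expR (- ((resolution^-1 * width R base_quota j) ^+ 2 /
           (8 * (quota base_quota j)%:R))) <= ((k.+1 * T)%:R ^+ 6)^-1 :> R.
Proof.
have m0 := resolution_gt0.
have n00 : 0 < base_quota%:R :> R by rewrite ltr0n.
have -> : (resolution^-1 * width R base_quota j) ^+ 2 / (8 * (quota base_quota j)%:R)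
    = base_quota%:R / (8 * resolution ^+ 2).
  rewrite quotaE /width natrM natrX.
  by field; rewrite !gt_eqF//= expf_neq0.
apply: (@le_trans _ _ (expR (- (6 * log_pulls%:R)))).
  have m2 : 0 < 8 * resolution ^+ 2 by apply: mulr_gt0 => //; exact: exprn_gt0.
  rewrite ler_expR lerN2 ler_pdivlMr//.
  by have := ltW quota_bound_lt; rewrite /quota_bound; lra.
have KT0 : 0 < (k.+1 * T)%:R :> R by rewrite ltr0n muln_gt0 /= (ltn_trans _ T2).
rewrite expRN lef_pV2 ?posrE ?expR_gt0 ?exprn_gt0//.
rewrite expRM_natl lerXn2r ?nnegrE ?expR_ge0 ?(ltW KT0)//.
rewrite -[log_pulls%:R]mulr1 expRM_natl.
apply: (@le_trans _ _ (2 ^+ log_pulls)); last by rewrite lerXn2r ?nnegrE ?expR_ge0// expR1_ge2.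
by rewrite -natrX ler_nat ltnW// trunc_log_ltn.
Qed.

(* If no batch can be completed, the schedule is deterministic; otherwise [rho]
   is not small, and [T^-4] is negligible against it.  This is why [log (1 / rho)]
   does not enter the number of pulls. *)
Lemma base_quota_small : (base_quota <= T)%N -> 1 <= rho ^+ 2 * T%:R.
Proof.
rewrite -(ler_nat R) => nT; have /andP[r0 r1] := rho01.
have : resolution ^+ 2 <= T%:R.
  by rewrite (le_trans quota_bound_ge)// (le_trans (ltW quota_bound_lt)).
rewrite /resolution expr_div_n ler_pdivrMr ?exprn_gt0// [T%:R * _]mulrC; apply: le_trans.
rewrite exprn_ege1// -mulrA -natrM -(natrM _ 16) ler1n.
by rewrite !muln_gt0.
Qed.

Context (d : measure_display) (Omega : measurableType d)
  (P : probability Omega R) (m : nat) (D : reward_dists R k.+1)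
  (Z : input_index m k.+1 -> {RV P >-> R}).
Hypotheses (D01 : supported01 D) (DZ : bandit_inputs D Z).

Lemma prob_bad_range : P (bad_range Z) = 0%E.
Proof.
have mC : measurable (~` `[0, 1]%classic : set R) by exact: measurableC.
by have := internal_uniform DZ 0%N mC; rewrite uniform_prob_compl01.
Qed.

Lemma prob_bad_theta :
  (P (bad_theta base_quota T D Z resolution^-1) <= (rho / 4)%:E)%E.
Proof.
have m0 := resolution_gt0; have /andP[r0 _] := rho01.
rewrite /bad_theta -big_enum /=.
apply: le_trans (measure_bigsetU_le _ (c := 4 / resolution) _ _) _.
- by move=> x; exact: measurable_bad_theta_aux.
(* After division by the width, the event says that the internal number is within [2 / resolution]
   of [y]. *)
- move=> x; set y := 2 ^+ x.2 * gap D x.1 - 1.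
  rewrite (_ : [set w | _] =
      Z (inl 0%N) @^-1` `[y - 2 / resolution, y + 2 / resolution]%classic).
    have mI := measurable_itv `[y - 2 / resolution, y + 2 / resolution].
    rewrite [leLHS](internal_uniform DZ 0%N mI).
    have e0 : 0 <= resolution^-1 by rewrite invr_ge0 ltW.
    apply: le_trans (uniform_prob_itv_le _) _; first by lra.
    by rewrite lee_fin; lra.
  have w0 : 0 < width R base_quota x.2 by exact: width_gt0.
  apply/seteqP; split=> w /=; rewrite in_itv/= quotaE /xi_of.
    have -> : 2 ^+ x.2 * width R base_quota x.2 * gap D x.1 -
        (1 + Z (inl 0%N) w) * width R base_quota x.2 =
        (y - Z (inl 0%N) w) * width R base_quota x.2 by rewrite /y; ring.
    rewrite normrM (gtr0_norm w0) ler_pM2r// ler_norml => /andP[h1 h2].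
    by apply/andP; split; lra.
  move=> /andP[h1 h2].
  have -> : 2 ^+ x.2 * width R base_quota x.2 * gap D x.1 -
      (1 + Z (inl 0%N) w) * width R base_quota x.2 =
      (y - Z (inl 0%N) w) * width R base_quota x.2 by rewrite /y; ring.
  rewrite normrM (gtr0_norm w0) ler_pM2r// ler_norml.
  by apply/andP; split; lra.
- rewrite -cardT card_prod !card_ord lee_fin natrM -/log_horizon /resolution.
  have l0 : 0 < log_horizon%:R :> R by rewrite ltr0n.
  have k0 : 0 < k.+1%:R :> R by rewrite ltr0n.
  move: l0 k0; set l := log_horizon%:R; set K := k.+1%:R => l0 k0.
  rewrite le_eqVlt; apply/orP; left; apply/eqP; field.
  by rewrite !gt_eqF.
Qed.

(** If not even the first block fits into the horizon, all events of the union are empty. The value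
    0 in this case is what makes arbitrarily small [rho] possible. *)
Lemma prob_bad_rewards i :
  (P (bad_rewards base_quota T D Z resolution^-1 i) <=
   (if (base_quota <= T)%N then 2 / T%:R ^+ 4 else 0)%:E)%E.
Proof.
have T0 : 0 < T%:R :> R by rewrite ltr0n (ltn_trans _ T2).
pose c : R := if (base_quota <= T)%N then 2 / ((k.+1 * T)%:R ^+ 6) else 0.
have c0 : 0 <= c by rewrite /c; case: ifP => // _; rewrite divr_ge0// exprn_ge0.
rewrite /bad_rewards -big_enum /=.
apply: le_trans (measure_bigsetU_le _ (c := c) _ _) _.
- by move=> x; exact: measurable_bad_rewards_aux.
- move=> x; have [sT|sT] := boolP (x.1.2 + quota base_quota x.2 <= T)%N; last first.
    by rewrite (_ : [set w | _] = set0) ?measure0//; apply/seteqP; split=> // w [].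
  have qT : (quota base_quota x.2 <= T)%N by lia.
  have nT : (base_quota <= T)%N.
    by apply: leq_trans qT; rewrite leq_pmulr ?expn_gt0.
  rewrite /c nT.
  rewrite (_ : [set w | _] = [set w | resolution^-1 * width R base_quota x.2 <
     `|block_dev D (rewards_of Z i w) x.1.1 x.1.2 (quota base_quota x.2)|]); last first.
    by apply/seteqP; split=> w // [].
  have q0 : (0 < quota base_quota x.2)%N by exact: quota_gt0.
  have /andP[e0 e1] := eta_itv.
  apply: le_trans (block_dev_tail D01 DZ i x.1.1 x.1.2 q0 _) _.
    have w0 := ltW (@width_gt0 R _ (isT : 0 < base_quota)%N x.2).
    rewrite quotaE mulr_ge0//= (le_trans (_ : _ <= 1 * width R base_quota x.2))//.
      by rewrite ler_wpM2r//; lra.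
    rewrite mulrA ler_wpM2r//.
    have : 1 <= (2 : R) ^+ x.2 by rewrite exprn_ege1// ler1n.
    by lra.
  by rewrite lee_fin ler_wpM2l// tail_le.
- rewrite -cardT !card_prod !card_ord lee_fin /c; case: ifP => _; last by rewrite mulr0.
  have K1 : 1 <= k.+1%:R :> R by rewrite ler1n.
  have K0 : 0 < k.+1%:R :> R by rewrite ltr0n.
  rewrite !natrM; move: K0 K1; set a : R := k.+1%:R => K0 K1.
  (* There are [K T^2] events of probability at most [2 / (K T)^6] each. *)
  have -> : a * T%:R * T%:R * (2 / (a * T%:R) ^+ 6) = 2 / T%:R ^+ 4 * (a ^+ 5)^-1.
    by field; rewrite !gt_eqF.
  rewrite ler_piMr ?divr_ge0 ?exprn_ge0//.
  by rewrite invf_le1 ?exprn_ege1// exprn_gt0.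
Qed.

End parameters.

(** * Replicability and expected regret *)

Section guarantees.
Context (R : realType) (k T : nat) (rho : R).

Definition elim_algorithm : bandit_algorithm R k.+1 :=
  BanditAlgorithm (@measurable_elim_policy R k (base_quota k T rho)).

Hypotheses (T2 : (2 <= T)%N) (rho01 : 0 < rho <= 1).

Let n0_gt0 : (0 < base_quota k T rho)%N := isT.

Lemma fiber_measurable_arm_at (d : measure_display) (Omega : measurableType d)
    (P : probability Omega R) (m : nat) (Z : input_index m k.+1 -> {RV P >-> R})
    i t :
  fiber_measurable (fun w => arm_at elim_algorithm (xi_of Z w) (rewards_of Z i w) t).
Proof.
move=> a; apply: (policy_measurable elim_algorithm
  (xi := fun n w => Z (inl n) w) (r := fun t a w => Z (inr (i, t, a)) w)).
  by move=> n; exact: measurable_funPT.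
by move=> s b; exact: measurable_funPT.
Qed.

Lemma fiber_measurable_map (d : measure_display) (Omega : measurableType d)
    (I : Type) (X : countType) (f : I -> Omega -> X) (s : seq I) :
  (forall t, fiber_measurable (f t)) ->
  fiber_measurable (fun w => [seq f t w | t <- s]).
Proof.
move=> mf; elim: s => [|t s IH]; first exact: fiber_measurable_cst.
apply: (fiber_measurable_case (g := fun x w => x :: [seq f t w | t <- s]) (mf t)).
by move=> x; exact: (fiber_measurable_comp (cons x)).
Qed.

Lemma elim_replicable : replicable T elim_algorithm rho.
Proof.
move=> D D01 d Omega P Z DZ; have /andP[rho0 rho1] := rho01.
set E := [set w | _].
pose bad := bad_rewards (base_quota k T rho) T D Z (resolution k T rho)^-1.
pose badth := bad_theta (base_quota k T rho) T D Z (resolution k T rho)^-1.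
have m_arms i : fiber_measurable
    (fun w => arms elim_algorithm (xi_of Z w) (rewards_of Z i w) T).
  by apply: fiber_measurable_map => t; exact: fiber_measurable_arm_at.
(* [P E] is bounded through the complement, which requires [E] to be measurable; the two lists of
   arms are compared by cases on the first. *)
have mE : measurable E.
  have := fiber_measurable_case (g := fun x w =>
    x == arms elim_algorithm (xi_of Z w) (rewards_of Z ord_max w) T) (m_arms ord0).
  move=> /(_ (fun x => fiber_measurable_comp (eq_op x) (m_arms ord_max)) true).
  rewrite (_ : _ @^-1` _ = E)//.
  by apply/seteqP; split=> w /= => [/eqP|/eqP].
have mbad i : measurable (bad i) by exact: measurable_bad_rewards.
have mbadth : measurable badth by exact: measurable_bad_theta.
have mrange : measurable (bad_range Z) by exact: measurable_bad_range.
have sub : ~` E `<=` bad_range Z `|` (badth `|` (bad ord0 `|` bad ord_max)).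
  move=> w nE; apply: contrapT => /not_orP[nr /not_orP[nt /not_orP[nb0 nb1]]].
  apply: nE; apply: (lockstep_arms n0_gt0 D01 (eta_itv k T rho01)).
  - by move/contrapT: nr; rewrite /= in_itv.
  - exact: (good_not_bad n0_gt0 nb0).
  - exact: (good_not_bad n0_gt0 nb1).
  - exact: (separated_not_bad n0_gt0 nt).
have PE : (P (~` E) <= (rho)%:E)%E.
  have mU1 : measurable (bad ord0 `|` bad ord_max) by exact: measurableU.
  have mU2 : measurable (badth `|` (bad ord0 `|` bad ord_max)) by exact: measurableU.
  have mU3 : measurable (bad_range Z `|` (badth `|` (bad ord0 `|` bad ord_max))).
    exact: measurableU.
  apply: le_trans (le_measure P _ _ sub) _; rewrite ?inE//.
    exact: measurableC.
  apply: le_trans (measureU2 _ _ _) _ => //.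
  rewrite [X in (X + _)%E](prob_bad_range DZ) add0e.
  apply: le_trans (measureU2 _ _ _) _ => //.
  (* The budget: [rho / 4] for the threshold and [rho / 4] for the rewards of each execution. *)
  apply: (@le_trans _ _ ((rho / 4)%:E + (rho / 4 + rho / 4)%:E)%E); last first.
    by rewrite -EFinD lee_fin; lra.
  apply: leeD; first exact: prob_bad_theta.
  apply: le_trans (measureU2 _ _ _) _ => //.
  suff Pb i : (P (bad i) <= (rho / 4)%:E)%E by rewrite EFinD; apply: leeD; exact: Pb.
  apply: le_trans (prob_bad_rewards T2 rho01 D01 DZ i) _.
  rewrite lee_fin; case: ifP => [nT|_]; last by lra.
  have := base_quota_small rho01 nT.
  have T2R : 2 <= T%:R :> R by rewrite ler_nat.
  have T0 : 0 < T%:R :> R by lra.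
  move=> h; have h1 : T%:R^-1 <= rho.
    rewrite -div1r ler_pdivrMr//; apply: le_trans h _.
    by rewrite ler_wpM2r ?(ltW T0)// expr2 ler_piMl// ltW.
  (* Three factors [2 / T] are at most 1 and the remaining [1 / T] is at most [rho], which leaves
     [rho / 4]. *)
  have -> : 2 / T%:R ^+ 4 = (2 / T%:R) * (2 / T%:R) * (2 / T%:R) * T%:R^-1 / 4 :> R.
    by field; rewrite gt_eqF.
  have h2 : 0 <= (2 / T%:R : R) by rewrite divr_ge0// ltW.
  have h3 : (2 / T%:R : R) <= 1 by rewrite ler_pdivrMr// mul1r.
  rewrite ler_wpM2r// (le_trans _ h1)// ler_piMl ?invr_ge0 ?(ltW T0)//.
  by apply: mulr_ile1 => //; exact: mulr_ile1.
have fE : P E \is a fin_num by exact: fin_num_measure.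
move: PE; rewrite [leLHS](probability_setC P mE) -(fineK fE) -EFinB !lee_fin.
by move=> PE; lra.
Qed.

Lemma pullsE (D : reward_dists R k.+1) n0 (xi : nat -> R) (r : nat -> 'I_k.+1 -> R) :
  \sum_(t < T) gap D (arm_at (elim_policy n0) xi r t) =
  \sum_(j < k.+1 | 0 < gap D j) (pulls n0 xi r j T)%:R * gap D j.
Proof.
rewrite [RHS]big_mkcond /=.
transitivity (\sum_(j < k.+1) \sum_(t < T)
    (arm_at (elim_policy n0) xi r t == j)%:R * gap D j).
  rewrite exchange_big /=; apply: eq_bigr => t _.
  rewrite (bigD1 (arm_at (elim_policy n0) xi r t))//= eqxx mul1r big1 ?addr0// => j.
  by rewrite eq_sym => /negbTE ->; rewrite mul0r.
apply: eq_bigr => j _; rewrite -mulr_suml -natr_sum -/(pulls _ _ _ _ _).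
have := gap_ge0 D j; rewrite le_eqVlt => /predU1P[<-|->//].
by rewrite mulr0 if_same.
Qed.

(** On the bad event the regret is at most [T] times the sum of the gaps, and [T] times its
    probability is at most 1: this produces the summand [gap D j]. Elsewhere [pulls_gap_le] gives
    the other summand. *)
Lemma elim_regret (D : reward_dists R k.+1) (D01 : supported01 D)
    (d : measure_display) (Omega : measurableType d) (P : probability Omega R)
    (Z : input_index 1 k.+1 -> {RV P >-> R}) : bandit_inputs D Z ->
  (expected_regret T elim_algorithm D Z <=
   (\sum_(j < k.+1 | 0 < gap D j)
      (gap D j + 48 * (base_quota k T rho)%:R / gap D j))%:E)%E.
Proof.
move=> DZ.
pose bad := bad_rewards (base_quota k T rho) T D Z (resolution k T rho)^-1 ord0.
pose X w := \sum_(t < T) mean D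
  (arm_at elim_algorithm (xi_of Z w) (rewards_of Z ord0 w) t).
pose E := bad `|` bad_range Z.
have mbad : measurable bad by exact: measurable_bad_rewards.
have mE : measurable E by apply: measurableU => //; exact: measurable_bad_range.
pose beta := \sum_(j < k.+1 | 0 < gap D j) 48 * (base_quota k T rho)%:R / gap D j.
pose gam := \sum_(j < k.+1 | 0 < gap D j) gap D j.
have beta0 : 0 <= beta by apply: sumr_ge0 => j /ltW j0; rewrite divr_ge0// mulr_ge0.
have gam0 : 0 <= gam by apply: sumr_ge0 => j /ltW.
have mean01 a : 0 <= mean D a <= 1 by exact: bounded_law_mean.
have XE w : T%:R * best_mean D - X w = \sum_(t < T) gap D
    (arm_at elim_algorithm (xi_of Z w) (rewards_of Z ord0 w) t).
  rewrite /gap sumrB sumr_const card_ord mulr_natl.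
  by [].
(* Written additively, both sides are nonnegative, so monotonicity and additivity of integrals of
   nonnegative functions apply. *)
have X_ge w : T%:R * best_mean D <= X w + T%:R * gam * \1_E w + beta.
  suff : T%:R * best_mean D - X w <= T%:R * gam * \1_E w + beta by lra.
  rewrite XE pullsE indicE.
  have [wE|/negP wE] := boolP (w \in E).
    rewrite mulr1 ler_wpDr// /gam mulr_sumr; apply: ler_sum => j j0.
    rewrite ler_wpM2r ?(ltW j0)// ler_nat.
    rewrite -[leqRHS]card_ord -sum1_card; apply: leq_sum => t _.
    by case: eqP.
  rewrite mulr0 add0r; apply: ler_sum => j j0.
  have nbad : ~ bad w by move=> b; apply: wE; rewrite inE; left.
  have xi01 : 0 <= xi_of Z w 0 <= 1.
    apply: contrapT => b; apply: wE; rewrite inE; right.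
    by rewrite /bad_range /= in_itv.
  have := pulls_gap_le n0_gt0 D01 (eta_itv k T rho01) j xi01 (good_not_bad n0_gt0 nbad).
  by rewrite ler_pdivlMr// expr2 mulrA.
have mX : measurable_fun setT X.
  apply: measurable_sum => t.
  apply: (measurable_fun_case (g := fun a w => mean D a)) => //.
  exact: fiber_measurable_arm_at.
have X0 w : 0 <= X w by apply: sumr_ge0 => t _; case/andP: (mean01
  (arm_at elim_algorithm (xi_of Z w) (rewards_of Z ord0 w) t)).
have XT w : X w <= T%:R * best_mean D.
  by rewrite -subr_ge0 XE; apply: sumr_ge0 => t _; exact: gap_ge0.
have Tgam0 : 0 <= T%:R * gam by rewrite mulr_ge0.
have EX : (\int[P]_w (X w + T%:R * gam * \1_E w + beta)%:E =
    \int[P]_w (X w)%:E + (T%:R * gam)%:E * P E + beta%:E)%E.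
  have mI : measurable_fun setT (fun w => T%:R * gam * \1_E w).
    by apply: measurable_funM => //; exact: measurable_indic.
  have I0 w : 0 <= T%:R * gam * \1_E w by rewrite mulr_ge0.
  have mX' : measurable_fun setT (fun w => (X w)%:E) by exact/measurable_EFinP.
  have mI' : measurable_fun setT (fun w => (T%:R * gam * \1_E w)%:E).
    exact/measurable_EFinP.
  have mXI : measurable_fun setT (fun w => ((X w)%:E + (T%:R * gam * \1_E w)%:E)%E).
    exact: emeasurable_funD.
  have X0' w : setT w -> (0 <= (X w)%:E)%E by rewrite lee_fin.
  have I0' w : setT w -> (0 <= (T%:R * gam * \1_E w)%:E)%E by rewrite lee_fin.
  have XI0 w : setT w -> (0 <= (X w)%:E + (T%:R * gam * \1_E w)%:E)%E.
    by move=> _; rewrite adde_ge0// lee_fin.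
  have b0' w : setT w -> (0 <= (cst beta%:E : Omega -> \bar R) w)%E by rewrite lee_fin.
  under eq_integral do rewrite EFinD EFinD.
  rewrite (ge0_integralD P measurableT XI0 mXI b0' (measurable_cst _)).
  rewrite (ge0_integralD P measurableT X0' mX' I0' mI').
  rewrite integral_cst// [X in (_ * X)%E]probability_setT mule1; congr (_ + _ + _)%E.
  under eq_integral do rewrite EFinM.
  rewrite ge0_integralZl_EFin//; last exact/measurable_EFinP/measurable_indic.
  by rewrite integral_indic// setIT.
have PE : (T%:R%:E * P E <= 1)%E.
  apply: (@le_trans _ _ (T%:R%:E * (2 / T%:R ^+ 4)%:E)%E).
    apply: lee_wpmul2l; first by rewrite lee_fin.
    apply: le_trans (measureU2 _ _ _) _ => //; first exact: measurable_bad_range.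
    rewrite [X in (_ + X)%E](prob_bad_range DZ) adde0.
    apply: le_trans (prob_bad_rewards T2 rho01 D01 DZ ord0) _.
    by rewrite lee_fin; case: ifP => // _; rewrite divr_ge0// exprn_ge0.
  have T2R : 2 <= T%:R :> R by rewrite ler_nat.
  have T0 : 0 < T%:R :> R by lra.
  rewrite -EFinM lee_fin mulrA ler_pdivrMr ?exprn_gt0// mul1r [leRHS]exprS.
  rewrite ler_wpM2l ?(ltW T0)// (le_trans T2R)// ler_eXnr//; lra.
have intX : (\int[P]_w (X w)%:E = 'E_P[X])%E by rewrite unlock.
have Xfin : ('E_P[X] \is a fin_num)%E.
  rewrite -intX ge0_fin_numE; last by apply: integral_ge0 => w _; rewrite lee_fin.
  apply: (@le_lt_trans _ _ (\int[P]_w (T%:R * best_mean D)%:E)%E).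
    apply: ge0_le_integral => //.
    - by move=> w _; rewrite lee_fin.
    - exact/measurable_EFinP.
    - by move=> w _; rewrite lee_fin.
  by rewrite integral_cst// [X in (_ * X)%E]probability_setT mule1 ltry.
have main : ((T%:R * best_mean D)%:E <= 'E_P[X] + gam%:E + beta%:E)%E.
  apply: (@le_trans _ _ (\int[P]_w (X w + T%:R * gam * \1_E w + beta)%:E)%E).
    rewrite -[leLHS]mule1 -[X in (_ * X)%E](probability_setT P) -integral_cst//.
    apply: ge0_le_integral => //.
    - move=> w _; rewrite lee_fin; exact: le_trans (X0 w) (XT w).
    - apply/measurable_EFinP; apply: measurable_funD => //; apply: measurable_funD => //.
      by apply: measurable_funM => //; exact: measurable_indic.
    - by move=> w _; rewrite lee_fin.
  rewrite EX intX leeD2r// leeD2l// mulrC EFinM -muleA -[leRHS]mule1.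
  by apply: lee_wpmul2l => //; rewrite lee_fin.
rewrite /expected_regret -/X big_split /= -/gam -/beta.
by rewrite leeBlDr// (le_trans main)// EFinD -addeA [leLHS]addeC.
Qed.
End guarantees.

(** * Numerical constants of the regret bound *)

Section constants.
Context (R : realType).

(** Equivalent to [exp (-1/2) >= 1/2], an instance of [exp x >= 1 + x]. *)
Lemma ln2_ge : 2^-1 <= ln 2 :> R.
Proof.
rewrite -[leLHS]expRK ler_ln ?posrE ?expR_gt0//.
rewrite -[leLHS]invrK -expRN -[leRHS]invrK lef_pV2 ?posrE ?invr_gt0 ?expR_gt0//.
by have := expR_ge1Dx (- 2^-1 : R); lra.
Qed.

Lemma ln_nat_ge (n : nat) : (2 <= n)%N -> 2^-1 <= ln n%:R :> R.
Proof.
move=> n2; apply: le_trans ln2_ge _.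
by rewrite ler_ln ?posrE ?ltr0n ?ler_nat// (ltn_trans _ n2).
Qed.

Lemma trunc_log_ln_le (n : nat) : (2 <= n)%N ->
  (trunc_log 2 n).+1%:R <= 4 * ln n%:R :> R.
Proof.
move=> n2; have n0 : (0 < n)%N by exact: ltn_trans n2.
have h : ln (2 ^+ trunc_log 2 n) <= ln n%:R :> R.
  by rewrite ler_ln ?posrE ?exprn_gt0 ?ltr0n// -natrX ler_nat trunc_logP.
move: h; rewrite lnXn// -[leLHS]mulr_natl => h.
have h2 := @ler_wpM2l R (trunc_log 2 n)%:R (ler0n _ _) _ _ ln2_ge.
have -> : (trunc_log 2 n).+1%:R = (trunc_log 2 n)%:R + 1 :> R by rewrite natr1.
by have := ln_nat_ge n2; lra.
Qed.

(** 48 comes from [pulls_gap_le]; 49 is the 48 of [quota_bound] plus 1 for rounding up;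
    [64 = 16 * 4] from [resolution] and [log_horizon <= 4 ln T]; 8 from [log_pulls <= 8 L]. *)
Definition regret_constant : R := 48 * 49 * (64 ^+ 2 * 8).

Lemma regret_constants (k T : nat) (rho : R) : (0 < k)%N -> (2 <= T)%N ->
  0 < rho <= 1 ->
  let A := k.+1%:R ^+ 2 * ln T%:R ^+ 2 / rho ^+ 2 in
  let L := ln (k.+1%:R * T%:R * ln T%:R) in
  1 <= A /\ 48 * (base_quota k T rho)%:R <= regret_constant * A * L.
Proof.
move=> k0 T2 rho01 A L; have /andP[r0 r1] := rho01.
have lT := ln_nat_ge T2.
have T2R : 2 <= T%:R :> R by rewrite ler_nat.
have K2R : 2 <= k.+1%:R :> R by rewrite ler_nat.
have KT4 : 4 <= k.+1%:R * T%:R :> R by rewrite (_ : 4 = 2 * 2 :> R) ?ler_pM//; lra.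
split.
  rewrite ler_pdivlMr ?exprn_gt0// mul1r -exprMn.
  have : 1 <= k.+1%:R * ln T%:R :> R by rewrite (_ : 1 = 2 * 2^-1 :> R) ?ler_pM// divff.
  by move=> h; rewrite lerXn2r ?nnegrE ?(ltW r0)//; lra.
(* [ln T] may be below 1, so [K T] is compared with the square of [K T ln T]: as [K T >= 4] and
   [ln T >= 1/2], one has [K T (ln T)^2 >= 1]. *)
have lX : ln (k.+1 * T)%:R <= 2 * L :> R.
  rewrite mulr_natl -lnXn; last by rewrite !mulr_gt0//; lra.
  rewrite natrM ler_ln ?posrE ?exprn_gt0 ?mulr_gt0//; try lra.
  have : 1 <= (k.+1%:R * T%:R) * ln T%:R ^+ 2 :> R.
    apply: (@le_trans _ _ (4 * 2^-1 ^+ 2)).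
      by rewrite le_eqVlt; apply/orP; left; apply/eqP; field.
    have sq : 2^-1 ^+ 2 <= ln T%:R ^+ 2 :> R by rewrite lerXn2r ?nnegrE//; lra.
    by apply: ler_pM => //; exact: sqr_ge0.
  move: KT4; set a := k.+1%:R * T%:R => KT4 h.
  by rewrite exprMn expr2 -mulrA ler_peMr//; lra.
have lam : (log_pulls k T)%:R <= 8 * L :> R.
  have KT : (2 <= k.+1 * T)%N by rewrite (leq_trans T2)// leq_pmull.
  by have := trunc_log_ln_le KT; rewrite /log_pulls; lra.
have hor : (log_horizon T)%:R <= 4 * ln T%:R :> R by exact: trunc_log_ln_le.
have res : resolution k T rho ^+ 2 <= 64 ^+ 2 * A.
  rewrite /resolution /A expr_div_n [leRHS]mulrA ler_wpM2r ?invr_ge0 ?sqr_ge0//.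
  rewrite (_ : 64 ^+ 2 * _ = (16 * k.+1%:R * (4 * ln T%:R)) ^+ 2); last by ring.
  by rewrite lerXn2r ?nnegrE ?mulr_ge0// ?ler_wpM2l ?mulr_ge0//; lra.
have nq : (base_quota k T rho)%:R <= quota_bound k T rho + 1.
  rewrite /base_quota -natr1 lerD2r truncn_le//.
  exact: le_trans (sqr_ge0 (resolution k T rho)) (quota_bound_ge _ _ _).
have q1 : 1 <= resolution k T rho ^+ 2 * (log_pulls k T)%:R.
  have m16 : 16 <= resolution k T rho by exact: resolution_ge16.
  by apply: mulr_ege1; [apply: exprn_ege1; lra|rewrite ler1n].
have q2 : resolution k T rho ^+ 2 * (log_pulls k T)%:R <= 64 ^+ 2 * A * (8 * L).
  by rewrite ler_pM ?sqr_ge0.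
move: nq; rewrite /quota_bound -[48 * _ * _]mulrA => nq.
rewrite (_ : regret_constant * A * L = 48 * (49 * (64 ^+ 2 * A * (8 * L)))).
  rewrite ler_wpM2l// (le_trans nq)//.
  by rewrite (le_trans (_ : _ <= 49 * (resolution k T rho ^+ 2 * (log_pulls k T)%:R)))
    ?ler_wpM2l//; lra.
by rewrite /regret_constant; ring.
Qed.

Lemma elim_regret_final (k T : nat) (rho : R) (D : reward_dists R k.+1) :
  (2 <= T)%N -> 0 < rho <= 1 -> supported01 D ->
  \sum_(j < k.+1 | 0 < gap D j)
      (gap D j + 48 * (base_quota k T rho)%:R / gap D j) <=
  regret_constant * (k.+1%:R ^+ 2 * ln T%:R ^+ 2 / rho ^+ 2) *
    \sum_(j < k.+1 | 0 < gap D j)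
      (gap D j + ln (k.+1%:R * T%:R * ln T%:R) / gap D j).
Proof.
move=> T2 rho01 D01; rewrite mulr_sumr; apply: ler_sum => j j0.
(* A single arm has gap 0 and contributes no summand. With two arms or more, the factor [A] below is
   at least 1. *)
have k0 : (0 < k)%N.
  case: k D D01 j j0 => // D D01 j.
  have [i] := gap_eq0_ex D; by rewrite (ord1 i) (ord1 j) => ->; rewrite ltxx.
have [] := regret_constants k0 T2 rho01.
set A := k.+1%:R ^+ 2 * _ / _; set L := ln _ => A1 nL.
rewrite mulrDr lerD//.
  rewrite ler_peMl ?(ltW j0)// (le_trans A1)// ler_peMl ?(le_trans ler01 A1)//.
  by rewrite /regret_constant -natrX -!natrM ler1n.
by rewrite mulrA ler_wpM2r// invr_ge0 ltW.
Qed.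

End constants.

(** * Hoare-style rules with cost bounds *)

Section program_rules.
Context (R : realType) (K : nat) (xi : nat -> R) (r : nat -> 'I_K -> R).
Implicit Types (s : state R K) (Q : state R K -> Prop).

(** Total correctness: halting is part of the claim. The cost is only bounded above, so the branches
    of a conditional can share one bound. *)
Definition runs (c : cmd) s (N : nat) Q : Prop :=
  exists n s', [/\ exec xi r c s n s', (n <= N)%N & Q s'].

Lemma runs_le c s N N' Q Q' : runs c s N Q -> (N <= N')%N ->
  (forall s', Q s' -> Q' s') -> runs c s N' Q'.
Proof.
move=> [n [s' [e nN q]]] NN' QQ'; exists n, s'; split=> //; last exact: QQ'.
exact: leq_trans nN NN'.
Qed.

Lemma runs_skip s Q : Q s -> runs CSkip s 1 Q.
Proof. by exists 1%N, s; split=> //; exact: ExecSkip. Qed.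

Lemma runs_nset x i e s Q : Q (nset s x (neval s i) (neval s e)) ->
  runs (CNSet x i e) s (ncost i + ncost e).+1 Q.
Proof. by move=> q; do 2 eexists; split; [exact: ExecNSet| |exact: q]. Qed.

Lemma runs_rset x i e s Q : Q (rset s x (neval s i) (reval s e)) ->
  runs (CRSet x i e) s (ncost i + rcost e).+1 Q.
Proof. by move=> q; do 2 eexists; split; [exact: ExecRSet| |exact: q]. Qed.

Lemma runs_draw x i s Q : Q (rset (draw s) x (neval s i) (xi (draws s))) ->
  runs (CDraw x i) s (ncost i).+1 Q.
Proof. by move=> q; do 2 eexists; split; [exact: ExecDraw| |exact: q]. Qed.

Lemma runs_pull x i e s (a : 'I_K) Q : neval s e = a ->
  Q (rset (pull s a (r (size (trace s)) a)) x (neval s i) (r (size (trace s)) a)) ->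
  runs (CPull x i e) s (ncost i + ncost e).+1 Q.
Proof. by move=> ea q; do 2 eexists; split; [by apply: ExecPull ea| |exact: q]. Qed.

Lemma runs_seq c1 c2 s N1 N2 Q :
  runs c1 s N1 (fun s1 => runs c2 s1 N2 Q) -> runs (CSeq c1 c2) s (N1 + N2).+1 Q.
Proof.
move=> [n1 [s1 [e1 nN1 [n2 [s2 [e2 nN2 q]]]]]].
exists (n1 + n2).+1, s2; split=> //; first by apply: ExecSeq e1 e2.
by rewrite ltnS leq_add.
Qed.

Lemma runs_if b c1 c2 s N1 N2 Q :
  (beval s b -> runs c1 s N1 Q) -> (~~ beval s b -> runs c2 s N2 Q) ->
  runs (CIf b c1 c2) s (bcost b + maxn N1 N2).+1 Q.
Proof.
move=> h1 h2; case: (boolP (beval s b)) => sb.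
  have [n [s' [e nN q]]] := h1 sb; exists (bcost b + n).+1, s'; split=> //.
    by apply: ExecIf; rewrite sb.
  by rewrite ltnS leq_add2l (leq_trans nN)// leq_maxl.
have [n [s' [e nN q]]] := h2 sb; exists (bcost b + n).+1, s'; split=> //.
  by apply: ExecIf; rewrite (negbTE sb).
by rewrite ltnS leq_add2l (leq_trans nN)// leq_maxr.
Qed.

(** The index of the invariant is the number of iterations still allowed; a true test must leave it
    positive, which gives termination and the cost together. *)
Lemma runs_while b c N (I : nat -> state R K -> Prop) :
  (forall j s, I j s -> beval s b -> (0 < j)%N /\ runs c s N (I j.-1)) ->
  forall j s, I j s -> runs (CWhile b c) s ((bcost b + N).+1 * j + (bcost b).+1)
    (fun s' => exists2 j', I j' s' & ~~ beval s' b).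
Proof.
move=> step; elim=> [|j IH] s Is; case: (boolP (beval s b)) => sb.
- by have [] := step _ _ Is sb.
- by exists (bcost b).+1, s; split; [exact: ExecWhileF|rewrite muln0|exists 0%N].
- have [_ [n1 [s1 [e1 nN1 I1]]]] := step _ _ Is sb.
  have [n2 [s2 [e2 nN2 q]]] := IH _ I1.
  exists (bcost b + n1 + n2).+1, s2; split=> //; first exact: ExecWhileT e1 e2.
  by rewrite mulnS; move: nN1 nN2; set x := (_ * j)%N; lia.
exists (bcost b).+1, s; split; [exact: ExecWhileF|exact: leq_addl|by exists j.+1].
Qed.

End program_rules.

(** * The program *)

(* Memory layout.  Natural arrays: 2 [log_horizon], 3 [log_pulls], 4 [quota],
   5 [width], 6 and 7 size and entries of [live], 8 [pos], 9 [cnt], 10 round,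
   11 to 13 scratch.  Real arrays: 1 [theta], 2 [acc], 3 [best], 4 [sums],
   5 last reward, 6 [resolution]. *)
Notation nvar x := (NGet x (NConst 0)).
Notation rvar x := (RGet x (NConst 0)).
Notation "c1 ;; c2" := (CSeq c1 c2) (at level 90, right associativity).

(** Doublings of 1 are counted until [e] is exceeded, which yields [trunc_log] plus 1. The bound is
    a real expression because naturals have no product to form [K T]. *)
Definition log_cmd (x : nat) (e : rexp) : cmd :=
  CNSet 13 (NConst 0) (NConst 1) ;;
  CNSet x (NConst 0) (NConst 0) ;;
  CWhile (RLe (ROfN (nvar 13)) e)
    (CNSet 13 (NConst 0) (NAdd (nvar 13) (nvar 13)) ;;
     CNSet x (NConst 0) (NAdd (nvar x) (NConst 1))).

(** Reals cannot be rounded to naturals, so [truncn] plus 1 is found by linear search; its cost is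
    proportional to the value, which is polynomial. *)
Definition search_cmd (x : nat) (e : rexp) : cmd :=
  CNSet x (NConst 0) (NConst 0) ;;
  CWhile (RLe (ROfN (nvar x)) e) (CNSet x (NConst 0) (NAdd (nvar x) (NConst 1))).

Definition fill_cmd : cmd :=
  CNSet 11 (NConst 0) (NConst 0) ;;
  CWhile (NLe (NAdd (nvar 11) (NConst 1)) (nvar 1))
    (CNSet 7 (nvar 11) (nvar 11) ;;
     CNSet 11 (NConst 0) (NAdd (nvar 11) (NConst 1))).

Definition filter_cmd : cmd :=
  CNSet 11 (NConst 0) (NConst 0) ;;
  CNSet 12 (NConst 0) (NConst 0) ;;
  CWhile (NLe (NAdd (nvar 11) (NConst 1)) (nvar 6))
    (CIf (RLe (RSub (rvar 3) (RGet 4 (nvar 11))) (RMul (rvar 1) (ROfN (nvar 5))))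
       (CNSet 7 (nvar 12) (NGet 7 (nvar 11)) ;;
        CNSet 12 (NConst 0) (NAdd (nvar 12) (NConst 1)))
       CSkip ;;
     CNSet 11 (NConst 0) (NAdd (nvar 11) (NConst 1))).

Section program_loops.
Context (R : realType) (K : nat) (xi : nat -> R) (r : nat -> 'I_K -> R).
Implicit Types (s : state R K) (Q : state R K -> Prop).

(** [Base] is the frame: whatever the caller wants preserved, provided that it is stable under the
    writes of the loop and fixes the value of [e]. *)
Lemma runs_log x e (N : nat) (Base : state R K -> Prop) s :
  (0 < N)%N -> x != 13%N ->
  (forall s v, Base s -> Base (nset s 13 0 v)) ->
  (forall s v, Base s -> Base (nset s x 0 v)) ->
  (forall s, Base s -> reval s e = N%:R) -> Base s ->
  runs xi r (log_cmd x e) s ((30 + rcost e) * (trunc_log 2 N + 3))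
    (fun s' => Base s' /\ nmem s' x 0 = (trunc_log 2 N).+1).
Proof.
move=> N0 x13 B13 Bx Be Bs; set l := (trunc_log 2 N).+1.
have x13' : (13 == x)%N = false by rewrite eq_sym (negbTE x13).
pose I j s' := [/\ Base s', nmem s' x 0 = (l - j)%N, nmem s' 13 0 = (2 ^ (l - j))%N
  & (j <= l)%N].
apply: runs_le.
- apply: runs_seq; apply: runs_nset => /=; apply: runs_seq; apply: runs_nset => /=.
  apply: (@runs_while _ _ _ _ _ _ _ I) (l) _ _; last first.
    split=> /=; rewrite ?subnn //; first by apply: Bx; exact: B13.
      by rewrite /upd eqxx.
    by rewrite /upd x13' eqxx.
  move=> j s' [Bs' xE pE jl] /=; rewrite Be// pE ler_nat => lN.
  have j0 : (0 < j)%N.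
    rewrite lt0n; apply/eqP => j0; move: lN; rewrite j0 subn0 leqNgt.
    by rewrite trunc_log_ltn.
  split=> //; apply: runs_seq; apply: runs_nset => /=; apply: runs_nset => /=.
  have E : (l - j.-1 = (l - j).+1)%N by lia.
  split=> /=; rewrite ?E; [by apply: Bx; exact: B13| | |lia].
    by rewrite /upd eqxx (negbTE x13) /= xE addn1.
  by rewrite /upd x13' eqxx /= pE addnn -mul2n expnS.
- by rewrite /= /l; nia.
move=> s' /= [j [Bs' xE pE jl]]; rewrite Be// pE ler_nat -ltnNge => Nl.
split=> //; rewrite xE; case: j jl Nl {xE pE} => [|j] jl Nl; first by rewrite subn0.
(* Stopping with iterations left would mean that a power of 2 with exponent at most [trunc_log 2 N]
   exceeds [N]. *)
suff : (N < N)%N by rewrite ltnn.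
apply: leq_trans Nl _; apply: leq_trans (trunc_logP (isT : 1 < 2)%N N0).
by rewrite leq_exp2l// /l; lia.
Qed.

Lemma runs_search x e (v : R) (Base : state R K -> Prop) s :
  0 <= v -> (forall s v, Base s -> Base (nset s x 0 v)) ->
  (forall s, Base s -> reval s e = v) -> Base s ->
  runs xi r (search_cmd x e) s ((30 + rcost e) * (Num.truncn v + 3))
    (fun s' => Base s' /\ nmem s' x 0 = (Num.truncn v).+1).
Proof.
move=> v0 Bx Be Bs; set l := (Num.truncn v).+1.
pose I j s' := [/\ Base s', nmem s' x 0 = (l - j)%N & (j <= l)%N].
apply: runs_le.
- apply: runs_seq; apply: runs_nset => /=.
  apply: (@runs_while _ _ _ _ _ _ _ I) (l) _ _; last first.
    by split=> /=; rewrite ?subnn //; [exact: Bx|rewrite /upd eqxx].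
  move=> j s' [Bs' xE jl] /=; rewrite Be// xE -truncn_ge_nat// => lN.
  have j0 : (0 < j)%N by move: lN; rewrite /l; lia.
  split=> //; apply: runs_nset => /=.
  split=> /=; [exact: Bx| |by lia].
  by rewrite /upd eqxx /= xE; lia.
- by rewrite /= /l; nia.
move=> s' /= [j [Bs' xE jl]]; rewrite Be// xE -truncn_ge_nat// -ltnNge => Nl.
by split=> //; move: Nl; rewrite /l; lia.
Qed.

Lemma runs_fill (Base : state R K -> Prop) s :
  (forall s v, Base s -> Base (nset s 11 0 v)) ->
  (forall s j v, Base s -> Base (nset s 7 j v)) ->
  (forall s, Base s -> nmem s 1 0 = K) -> Base s ->
  runs xi r fill_cmd s (30 * (K + 1))
    (fun s' => Base s' /\ forall q, (q < K)%N -> nmem s' 7 q = q).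
Proof.
move=> B11 B7 BK Bs.
pose I j s' := [/\ Base s', nmem s' 11 0 = (K - j)%N, (j <= K)%N &
  forall q, (q < K - j)%N -> nmem s' 7 q = q].
apply: runs_le.
- apply: runs_seq; apply: runs_nset => /=.
  apply: (@runs_while _ _ _ _ _ _ _ I) (K) _ _; last first.
    by split=> //=; rewrite ?subnn//; [exact: B11].
  move=> j s' [Bs' qE jl fE] /=; rewrite BK// qE => lN.
  have j0 : (0 < j)%N by lia.
  split=> //; apply: runs_seq; apply: runs_nset => /=; apply: runs_nset => /=.
  split=> /=; [by apply: B11; exact: B7|by rewrite /upd /= qE; lia|by lia|].
  move=> q qK; rewrite /upd /= qE; case: eqP => [->//|/eqP qne].
  by apply: fE; lia.
- by rewrite /=; nia.
move=> s' /= [j [Bs' qE jl fE]]; rewrite BK// qE -ltnNge => Nl.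
by split=> // q qK; apply: fE; lia.
Qed.

End program_loops.

(** * One round as a program *)

Definition pull_cmd : cmd :=
  CPull 5 (NConst 0) (NGet 7 (nvar 8)) ;;
  CRSet 2 (NConst 0) (RAdd (rvar 2) (rvar 5)) ;;
  CNSet 9 (NConst 0) (NAdd (nvar 9) (NConst 1)) ;;
  CNSet 10 (NConst 0) (NAdd (nvar 10) (NConst 1)).

Definition finish_cmd : cmd :=
  CRSet 4 (nvar 8) (rvar 2) ;;
  CIf (BAnd (NLe (NConst 1) (nvar 8)) (RLe (rvar 2) (rvar 3))) CSkip
    (CRSet 3 (NConst 0) (rvar 2)) ;;
  CNSet 8 (NConst 0) (NAdd (nvar 8) (NConst 1)) ;;
  CNSet 9 (NConst 0) (NConst 0) ;;
  CRSet 2 (NConst 0) (ROfN (NConst 0)).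

(** Naturals have only addition, so the quota is quadrupled and the width doubled by sums. *)
Definition batch_cmd : cmd :=
  filter_cmd ;;
  CNSet 6 (NConst 0) (nvar 12) ;;
  CNSet 8 (NConst 0) (NConst 0) ;;
  CRSet 3 (NConst 0) (ROfN (NConst 0)) ;;
  CNSet 4 (NConst 0) (NAdd (NAdd (nvar 4) (nvar 4)) (NAdd (nvar 4) (nvar 4))) ;;
  CNSet 5 (NConst 0) (NAdd (nvar 5) (nvar 5)).

Definition round_cmd : cmd :=
  pull_cmd ;;
  CIf (NLe (nvar 4) (nvar 9))
    (finish_cmd ;; CIf (NLe (nvar 6) (nvar 8)) batch_cmd CSkip)
    CSkip.

Section program_rounds.
Context (R : realType) (k n0 T : nat) (xi : nat -> R) (r : nat -> 'I_k.+1 -> R).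
Implicit Types (s : state R k.+1) (st : elim_state R k).

Lemma runs_filter (L : seq 'I_k.+1) (b thr : R) (F : nat -> R)
    (Base : state R k.+1 -> Prop) s :
  (forall s j v, Base s -> Base (nset s 7 j v)) ->
  (forall s v, Base s -> Base (nset s 11 0 v)) ->
  (forall s v, Base s -> Base (nset s 12 0 v)) ->
  (forall s, Base s -> [/\ nmem s 6 0 = size L, rmem s 3 0 = b,
     forall q, rmem s 4 q = F q & rmem s 1 0 * (nmem s 5 0)%:R = thr]) ->
  Base s -> (forall q, (q < size L)%N -> nmem s 7 q = nth ord0 L q) ->
  runs xi r filter_cmd s (60 * (size L + 1))
    (fun s' => [/\ Base s', nmem s' 12 0 = size (survivors thr L b F) &
       forall q, (q < size (survivors thr L b F))%N ->
         nmem s' 7 q = nth ord0 (survivors thr L b F) q]).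
Proof.
move=> B7 B11 B12 BE Bs sL.
pose kept q := [seq nth ord0 L z | z <- iota 0 q & b - F z <= thr].
have keptS q : kept q.+1 = kept q ++ (if b - F q <= thr then [:: nth ord0 L q] else [::]).
  rewrite /kept (_ : iota 0 q.+1 = iota 0 q ++ [:: q]); last by rewrite -addn1 iotaD.
  by rewrite filter_cat map_cat /=; case: ifP.
have kept_size q : (size (kept q) <= q)%N.
  by rewrite size_map size_filter (leq_trans (count_size _ _))// size_iota.
pose I j s' := [/\ Base s', nmem s' 11 0 = (size L - j)%N, (j <= size L)%N,
  nmem s' 12 0 = size (kept (size L - j)%N) &
  (forall z, (z < size (kept (size L - j)%N))%N ->
     nmem s' 7 z = nth ord0 (kept (size L - j)%N) z) /\
  (forall z, (size L - j <= z < size L)%N -> nmem s' 7 z = nth ord0 L z)].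
(* The kept arms overwrite the entries already read: [size (kept q) <= q]. *)
apply: runs_le.
- apply: runs_seq; apply: runs_nset => /=; apply: runs_seq; apply: runs_nset => /=.
  apply: (@runs_while _ _ _ _ _ _ _ I) (size L) _ _; last first.
    split; [by apply: B12; exact: B11|by rewrite subnn|by []|by rewrite subnn|].
    by rewrite subnn; split=> [z //|z /andP[_ zL]]; rewrite /= /upd /= sL.
  move=> j s' [Bs' qE jl kE [keptE restE]] /=; have [LE bE FE wE] := BE _ Bs'.
  rewrite LE qE => lN; set q := (size L - j)%N in qE kE keptE restE lN *.
  have j0 : (0 < j)%N by move: lN jl; rewrite /q; lia.
  have E : (size L - j.-1 = q.+1)%N by move: j0 jl; rewrite /q; lia.
  have qL : (q < size L)%N by move: lN; lia.
  have kq := kept_size q.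
  split=> //; apply: runs_seq; apply: runs_if => /=; rewrite bE FE wE qE => bq.
    apply: runs_seq; apply: runs_nset => /=; apply: runs_nset => /=; apply: runs_nset => /=.
    have kS : kept q.+1 = rcons (kept q) (nth ord0 L q) by rewrite keptS bq cats1.
    split=> /=; rewrite ?E; [by apply: B11; apply: B12; exact: B7| |lia| |].
    - by rewrite /upd /= qE addn1.
    - by rewrite kS size_rcons /upd /= kE addn1.
    rewrite kS; split=> z zz; rewrite /upd /= kE qE.
      move: zz; rewrite size_rcons ltnS nth_rcons leq_eqVlt => /predU1P[->|zk].
        by rewrite eqxx ltnn restE// leqnn qL.
      by rewrite zk ltn_eqF// keptE.
    by case: eqP => [zk|_]; [lia|rewrite restE//; lia].
  apply: runs_skip; apply: runs_nset => /=.
  have kS : kept q.+1 = kept q by rewrite keptS (negbTE bq) cats0.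
  split=> /=; rewrite ?E; [exact: B11| |lia| |].
  - by rewrite /upd /= qE addn1.
  - by rewrite kS /upd /= kE.
  rewrite kS; split=> z zz; rewrite /upd /=; first exact: keptE.
  by rewrite restE//; lia.
- by rewrite /=; nia.
move=> s' /= [j [Bs' qE jl kE [keptE restE]]]; have [LE bE FE wE] := BE _ Bs'.
rewrite LE qE -ltnNge => Nl; have E : (size L - j)%N = size L by lia.
by rewrite E in kE keptE; split.
Qed.

(** Array 7 is unspecified beyond the live list, where [filter_cmd] leaves garbage. Array 4 agrees
    everywhere, since program and [elim_step] make the same writes to the sums. *)
Definition represents (theta : R) (t : nat) (h : seq ('I_k.+1 * R)) st s : Prop :=
  [/\ nmem s 0 0 = T, nmem s 4 0 = quota n0 (batch st),
      nmem s 5 0 = (n0 * 2 ^ batch st)%N, nmem s 6 0 = size (live st)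
    & forall q, (q < size (live st))%N -> nmem s 7 q = nth ord0 (live st) q] /\
  [/\ nmem s 8 0 = pos st, nmem s 9 0 = cnt st, nmem s 10 0 = t & trace s = h] /\
  [/\ rmem s 1 0 = theta, rmem s 2 0 = acc st, rmem s 3 0 = best st
    & forall q, rmem s 4 q = sums st q].

Lemma runs_pull_cmd theta t h L p c i a b F s :
  (p < size L)%N -> size h = t ->
  represents theta t h (ElimState L p c i a b F) s ->
  runs xi r pull_cmd s 50
    (represents theta t.+1 (rcons h (nth ord0 L p, r t (nth ord0 L p)))
       (ElimState L p c.+1 i (a + r t (nth ord0 L p)) b F)).
Proof.
move=> pL ht [/= [T0 n4 w5 L6 L7] [[p8 c9 t10 hE] [th1 a2 b3 F4]]].
apply: (@runs_le _ _ _ _ _ _ _ _ (represents theta t.+1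
    (rcons h (nth ord0 L p, r t (nth ord0 L p)))
    (ElimState L p c.+1 i (a + r t (nth ord0 L p)) b F))); last by [].
  apply: runs_seq; apply: (@runs_pull _ _ _ _ _ _ _ _ (nth ord0 L p)).
    by rewrite /= p8 L7.
  apply: runs_seq; apply: runs_rset => /=; apply: runs_seq; apply: runs_nset => /=.
  apply: runs_nset => /=; rewrite /represents /= /upd /= hE ht a2 c9 t10 !addn1.
  by do !split.
by [].
Qed.

Lemma runs_finish_cmd theta t h L p c i a b F s :
  represents theta t h (ElimState L p c i a b F) s ->
  runs xi r finish_cmd s 50
    (represents theta t h
       (ElimState L p.+1 0 i 0 (new_best p b a) (new_sums F p a))).
Proof.
move=> [/= [T0 n4 w5 L6 L7] [[p8 c9 t10 hE] [th1 a2 b3 F4]]].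
apply: (@runs_le _ _ _ _ _ _ _ _ (represents theta t h
       (ElimState L p.+1 0 i 0 (new_best p b a) (new_sums F p a)))); last by [].
  apply: runs_seq; apply: runs_rset => /=; apply: runs_seq; apply: runs_if => /=;
    rewrite /upd /= p8 a2 b3 => pab.
    apply: runs_skip; apply: runs_seq; apply: runs_nset => /=; apply: runs_seq.
    apply: runs_nset => /=; apply: runs_rset => /=.
    rewrite /represents /= /upd /= ?p8 ?a2 ?b3 addn1; do !split=> //.
      by case: p p8 pab => // p _ /andP[_ ab]; rewrite /new_best max_l.
    by move=> q; rewrite /new_sums; case: eqP.
  apply: runs_rset => /=; apply: runs_seq; apply: runs_nset => /=; apply: runs_seq.
  apply: runs_nset => /=; apply: runs_rset => /=.
  rewrite /represents /= /upd /= ?p8 ?a2 addn1; do !split=> //.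
    by case: p p8 pab => // p _; rewrite /= -ltNge => /ltW ba; rewrite max_r.
  by move=> q; rewrite /new_sums; case: eqP.
by [].
Qed.

Lemma runs_batch_cmd theta t h L p c i a b F s :
  represents theta t h (ElimState L p c i a b F) s ->
  runs xi r batch_cmd s (60 * (size L + 2))
    (represents theta t h
       (ElimState (survivors (theta * width R n0 i) L b F) 0 c i.+1 a 0 F)).
Proof.
move=> rep; have [/= [T0 n4 w5 L6 L7] _] := rep.
pose Base s := [/\ nmem s 0 0 = T, nmem s 4 0 = quota n0 i,
      nmem s 5 0 = (n0 * 2 ^ i)%N & nmem s 6 0 = size L] /\
  [/\ nmem s 9 0 = c, nmem s 10 0 = t & trace s = h] /\
  [/\ rmem s 1 0 = theta, rmem s 2 0 = a, rmem s 3 0 = b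
    & forall q, rmem s 4 q = F q].
have Bs : Base s by move: rep => [/= [? ? ? ? _] [[? ? ? ?] [? ? ? ?]]].
apply: (@runs_le _ _ _ _ _ _ _ _ (represents theta t h
  (ElimState (survivors (theta * width R n0 i) L b F) 0 c i.+1 a 0 F))); last by [].
  have B7 s' j v : Base s' -> Base (nset s' 7 j v) by [].
  have B11 s' v : Base s' -> Base (nset s' 11 0 v) by [].
  have B12 s' v : Base s' -> Base (nset s' 12 0 v) by [].
  have BE s' : Base s' -> [/\ nmem s' 6 0 = size L, rmem s' 3 0 = b,
      forall q, rmem s' 4 q = F q & rmem s' 1 0 * (nmem s' 5 0)%:R = theta * width R n0 i].
    by move=> [[_ _ -> ->] [_ [-> _ -> FE]]].
  apply: runs_seq; apply: runs_le (runs_filter B7 B11 B12 BE Bs L7) (leqnn _) _.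
  move=> s' [[[T0' n4' w5' L6'] [[c9 t10 hE] [th1 a2 b3 F4]]] k12 k7].
  apply: runs_seq; apply: runs_nset => /=; apply: runs_seq; apply: runs_nset => /=.
  apply: runs_seq; apply: runs_rset => /=; apply: runs_seq; apply: runs_nset => /=.
  apply: runs_nset => /=; rewrite /represents /= /upd /= n4' w5' k12; do !split=> //.
    by rewrite /quota expnS; lia.
  by rewrite expnS; lia.
by rewrite /=; lia.
Qed.

Lemma runs_round theta t h st s : (pos st < size (live st))%N -> size h = t ->
  represents theta t h st s ->
  let a := elim_choose st in
  runs xi r round_cmd s (60 * (size (live st) + 6))
    (represents theta t.+1 (rcons h (a, r t a)) (elim_step n0 theta st (r t a))).
Proof.
case: st => L p c i a b F /= pL ht rep; rewrite /elim_choose /=.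
set arm := nth ord0 L p; set st' := (X in represents _ _ _ X).
apply: (@runs_le _ _ _ _ _ _ _ _ (represents theta t.+1 (rcons h (arm, r t arm)) st')); last by [].
  apply: runs_seq; apply: runs_le (runs_pull_cmd pL ht rep) (leqnn _) _ => s1 rep1.
  have [/= [T0 n4 w5 L6 L7] [[p8 c9 t10 hE] _]] := rep1.
  apply: runs_if => /=; rewrite n4 c9 => nc.
    apply: runs_seq; apply: runs_le (runs_finish_cmd rep1) (leqnn _) _ => s2 rep2.
    have [/= [_ _ _ L6' _] [[p8' _ _ _] _]] := rep2.
    apply: runs_if => /=; rewrite L6' p8' => Lp.
      apply: runs_le (runs_batch_cmd rep2) (leqnn _) _ => s3.
      by rewrite /st' ltnNge nc /= ltnNge Lp.
    by apply: runs_skip; rewrite /st' ltnNge nc /= ltnNge Lp.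
  by apply: runs_skip; rewrite /st' ltnNge nc.
by rewrite /=; lia.
Qed.
End program_rounds.

(** * The complete program and its running time *)

Definition main_cmd : cmd :=
  log_cmd 2 (ROfN (nvar 0)) ;;
  log_cmd 3 (RMul (ROfN (nvar 1)) (ROfN (nvar 0))) ;;
  CRSet 6 (NConst 0) (RDiv (RMul (RMul (ROfN (NConst 16)) (ROfN (nvar 1)))
    (ROfN (nvar 2))) (rvar 0)) ;;
  search_cmd 4 (RMul (RMul (ROfN (NConst 48)) (RMul (rvar 6) (rvar 6)))
    (ROfN (nvar 3))) ;;
  CNSet 5 (NConst 0) (nvar 4) ;;
  CNSet 6 (NConst 0) (nvar 1) ;;
  fill_cmd ;;
  CDraw 1 (NConst 0) ;;
  CRSet 1 (NConst 0) (RAdd (ROfN (NConst 1)) (rvar 1)) ;;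
  CWhile (NLe (NAdd (nvar 10) (NConst 1)) (nvar 0)) round_cmd.

Section program_main.
Context (R : realType) (k T : nat) (rho : R).
Context (xi : nat -> R) (r : nat -> 'I_k.+1 -> R).
Hypotheses (T2 : (2 <= T)%N) (rho01 : 0 < rho <= 1) (xi0 : 0 <= xi 0%N).
Implicit Types s : state R k.+1.

Let n0 := base_quota k T rho.
Let hist t := history (elim_policy n0) xi r t.

Lemma size_history (A : policy R k.+1) t : size (history A xi r t) = t.
Proof. by elim: t => //= t IH; rewrite size_rcons IH. Qed.

Lemma live_size_le st t : run_inv n0 r t st -> (size (live st) <= k.+1)%N.
Proof. by move=> [/card_uniqP <- _ _ _ _]; rewrite -[leqRHS](card_ord k.+1) max_card. Qed.

Lemma runs_rounds s : represents n0 T (1 + xi 0%N) 0 [::] (elim_init R k) s ->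
  runs xi r (CWhile (NLe (NAdd (nvar 10) (NConst 1)) (nvar 0)) round_cmd) s
    ((60 * (k.+1 + 7)) * (T + 1)) (fun s' => trace s' = hist T).
Proof.
move=> rep0; have th0 : 0 <= 1 + xi 0%N by rewrite addr_ge0.
pose I j s' := (j <= T)%N /\
  represents n0 T (1 + xi 0%N) (T - j) (hist (T - j)) (elim_at n0 xi r (T - j)) s'.
apply: runs_le.
- apply: (@runs_while _ _ _ _ _ _ (60 * (k.+1 + 6)) I _ T); last first.
    by rewrite /I subnn; split.
  move=> j s' [jT rep] /=; have [/= [T0 _ _ _ _] [[_ _ t10 _] _]] := rep.
  rewrite t10 T0 => lT; have j0 : (0 < j)%N by move: lT jT; lia.
  split=> //.
  have inv := run_inv_at (isT : (0 < n0)%N) r (T - j) th0.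
  have [_ pL _ _ _] := inv; have Lk := live_size_le inv.
  apply: runs_le (runs_round xi r pL (size_history _ _) rep) _ _.
    by rewrite leq_mul2l /= leq_add2r.
  move=> s1; rewrite -elim_atS => rep1; split; first by move: jT; lia.
  by have -> : (T - j.-1 = (T - j).+1)%N by move: j0 jT; lia.
- by rewrite /=; nia.
move=> s' [j [jT [/= [T0 _ _ _ _] [[_ _ t10 hE] _]]]] /=.
rewrite t10 T0 -ltnNge => lT; rewrite hE; congr hist.
by move: lT jT; lia.
Qed.

Lemma runs_main :
  runs xi r main_cmd (init_state k.+1 T rho)
    (1000 * (T + k.+1 * T + Num.truncn (quota_bound k T rho) + 1))
    (fun s' => trace s' = hist T).
Proof.
have /andP[r0 r1] := rho01.
(* The frames accumulate what later phases rely on. [B0] also keeps the cells that are initially 0,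
   which serve as the initial counters and sums, and the fact that no number has been drawn, so that
   the draw returns [xi 0]. *)
pose B0 s := [/\ nmem s 0 0 = T, nmem s 1 0 = k.+1, nmem s 8 0 = 0%N,
    nmem s 9 0 = 0%N & nmem s 10 0 = 0%N] /\
  [/\ rmem s 0 0 = rho, rmem s 2 0 = 0, rmem s 3 0 = 0
    & forall q, rmem s 4 q = 0] /\ (draws s = 0%N /\ trace s = [::]).
pose B1 s := B0 s /\ nmem s 2 0 = log_horizon T.
pose B2 s := B1 s /\ nmem s 3 0 = log_pulls k T.
pose B3 s := B2 s /\ rmem s 6 0 = resolution k T rho.
pose B4 s := B3 s /\ [/\ nmem s 4 0 = n0, nmem s 5 0 = n0 & nmem s 6 0 = k.+1].
have T0 : (0 < T)%N by exact: ltn_trans T2.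
have tlT : (trunc_log 2 T <= T)%N.
  by apply: leq_trans (trunc_logP (isT : 1 < 2)%N T0); exact/ltnW/ltn_expl.
have KT0 : (0 < k.+1 * T)%N by rewrite muln_gt0.
have tlKT : (trunc_log 2 (k.+1 * T) <= k.+1 * T)%N.
  by apply: leq_trans (trunc_logP (isT : 1 < 2)%N KT0); exact/ltnW/ltn_expl.
have Binit : B0 (init_state k.+1 T rho) by [].
have B013 s v : B0 s -> B0 (nset s 13 0 v) by [].
have B02 s v : B0 s -> B0 (nset s 2 0 v) by [].
have B113 s v : B1 s -> B1 (nset s 13 0 v) by [].
have B13 s v : B1 s -> B1 (nset s 3 0 v) by [].
have B34 s v : B3 s -> B3 (nset s 4 0 v) by [].
have B411 s v : B4 s -> B4 (nset s 11 0 v) by [].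
have B47 s j v : B4 s -> B4 (nset s 7 j v) by [].
have e0 s : B0 s -> reval s (ROfN (nvar 0)) = T%:R by move=> [[/= -> _ _ _ _] _].
have e1 s : B1 s -> reval s (RMul (ROfN (nvar 1)) (ROfN (nvar 0))) = (k.+1 * T)%:R.
  by move=> [[[/= -> -> _ _ _] _] _]; rewrite natrM.
have e3 s : B3 s -> reval s (RMul (RMul (ROfN (NConst 48)) (RMul (rvar 6) (rvar 6)))
    (ROfN (nvar 3))) = quota_bound k T rho.
  by move=> [[_ /= ->] ->]; rewrite /quota_bound expr2.
have e4 s : B4 s -> nmem s 1 0 = k.+1 by move=> [[[[[[_ -> _ _ _] _] _] _] _] _].
have qb0 : 0 <= quota_bound k T rho.
  exact: le_trans (sqr_ge0 (resolution k T rho)) (quota_bound_ge _ _ _).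
apply: (@runs_le _ _ _ _ _ _ _ _ (fun s' => trace s' = hist T)); last by [].
  apply: runs_seq; apply: runs_le
    (runs_log xi r T0 (isT : 2 != 13)%N B013 B02 e0 Binit) (leqnn _) _ => s1 b1.
  apply: runs_seq; apply: runs_le
    (runs_log xi r KT0 (isT : 3 != 13)%N B113 B13 e1 b1) (leqnn _) _ => s2 b2.
  apply: runs_seq; apply: runs_rset => /=.
  set s3 := rset _ _ _ _.
  have b3 : B3 s3.
    have [[[[_ K1 _ _ _] [[rho0 _ _ _] _]] l2] _] := b2.
    by split=> //; rewrite /s3 /= /upd /= K1 l2 rho0.
  apply: runs_seq; apply: runs_le
    (runs_search xi r qb0 B34 e3 b3) (leqnn _) _ => s4 [b4 n4].
  apply: runs_seq; apply: runs_nset => /=; apply: runs_seq; apply: runs_nset => /=.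
  set s5 := nset _ _ _ _.
  have b5 : B4 s5.
    split; first exact: b4.
    by have [[[[[_ K1 _ _ _] _] _] _] _] := b4; rewrite /s5 /= /upd /= n4 K1.
  apply: runs_seq; apply: runs_le
    (runs_fill xi r B411 B47 e4 b5) (leqnn _) _ => s6 [b6 f6].
  apply: runs_seq; apply: runs_draw => /=; apply: runs_seq; apply: runs_rset => /=.
  apply: runs_rounds.
  have [[[[[[n0T K1 p8 c9 t10] [[rh a2 b3' F4] [dr tr]]] _] _] _] [q4 w5 L6]] := b6.
  rewrite /represents /= /upd /= n0T q4 w5 L6 p8 c9 t10 dr tr a2 b3' size_enum_ord.
  do !split=> //; rewrite ?/quota ?expn0 ?muln1// => q qk.
  by rewrite f6// nth_enum_ord.
rewrite /=; move: tlT tlKT T0.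
set tl := trunc_log 2 T; set tk := trunc_log 2 _; set qb := Num.truncn _.
by move=> h1 h2 h3; nia.
Qed.

End program_main.

Lemma elim_polynomial_time (R : realType) : 
  polynomial_time (fun T k (rho : R) => elim_algorithm k T rho).
Proof.
(* With [X = K + T + 1 / rho], [resolution <= 16 X^3] and [log_pulls <= X^2], so the search costs at
   most the order of [48 * 16^2 * X^8]; the 3 pays for [T], [K T] and 1. *)
exists main_cmd, (1000 * (3 + 48 * 16 ^ 2))%N, 8%N => T k rho T2 rho01 xi r xi01 r01.
have /andP[xi0 _] := xi01 0%N.
have [n [s [e nN q]]] := runs_main r T2 rho01 xi0.
exists n, s; split=> //; have /andP[r0 r1] := rho01.
set X := _ + _; have K1 : 1 <= k.+1%:R :> R by rewrite ler1n.
have T1 : 1 <= T%:R :> R by rewrite ler1n ltnW.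
have ri : 1 <= rho^-1 by rewrite invf_ge1.
have [KX TX rX] : [/\ k.+1%:R <= X, T%:R <= X & rho^-1 <= X] by rewrite /X; split; lra.
have X1 : 1 <= X by exact: le_trans TX.
have X0 : 0 <= X by exact: le_trans X1.
have T0 : (0 < T)%N by exact: ltn_trans T2.
have horX : (log_horizon T)%:R <= X.
  apply: le_trans TX; rewrite ler_nat.
  by apply: leq_trans (trunc_logP (isT : 1 < 2)%N T0); exact: ltn_expl.
have KT0 : (0 < k.+1 * T)%N by rewrite muln_gt0.
have KTX : (k.+1 * T)%:R <= X ^+ 2 by rewrite natrM expr2 ler_pM.
have lamX : (log_pulls k T)%:R <= X ^+ 2.
  apply: le_trans KTX; rewrite ler_nat.
  by apply: leq_trans (trunc_logP (isT : 1 < 2)%N KT0); exact: ltn_expl.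
have resX : resolution k T rho <= 16 * X ^+ 3.
  rewrite /resolution -!mulrA ler_wpM2l// !exprS expr0 mulr1.
  by rewrite ler_pM ?mulr_ge0 ?invr_ge0 ?(ltW r0)// ler_pM ?invr_ge0 ?(ltW r0).
have res0 : 0 <= resolution k T rho by apply/ltW/resolution_gt0.
have qbX : quota_bound k T rho <= 48 * 16 ^+ 2 * X ^+ 8.
  rewrite /quota_bound (_ : 48 * _ * X ^+ 8 = 48 * (16 * X ^+ 3) ^+ 2 * X ^+ 2); last by ring.
  have X3 : 0 <= 16 * X ^+ 3 by exact: le_trans resX.
  have res2 : 0 <= resolution k T rho ^+ 2 by exact: sqr_ge0.
  apply: ler_pM => //; first exact: mulr_ge0.
  by rewrite ler_wpM2l// lerXn2r ?nnegrE.
have X8 i : (i <= 8)%N -> X ^+ i <= X ^+ 8 by move=> i8; rewrite ler_weXn2l.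
apply: (@le_trans _ _
  (1000 * (T + k.+1 * T + Num.truncn (quota_bound k T rho) + 1))%N%:R).
  by rewrite ler_nat.
have scale (c N M : nat) : N%:R <= M%:R * X ^+ 8 ->
    (c * N)%:R <= (c * M)%:R * X ^+ 8 :> R.
  by move=> NM; rewrite !natrM -mulrA ler_wpM2l.
apply: scale.
have tq : (Num.truncn (quota_bound k T rho))%:R <= 48 * 16 ^+ 2 * X ^+ 8.
  apply: le_trans qbX; rewrite truncn_le//.
  exact: le_trans (sqr_ge0 (resolution k T rho)) (quota_bound_ge _ _ _).
have X8T : T%:R <= X ^+ 8 by apply: le_trans TX _; exact: (X8 1%N isT).
have X8KT : (k.+1 * T)%:R <= X ^+ 8 by apply: le_trans KTX _; exact: (X8 2%N isT).
have X81 : 1 <= X ^+ 8 by exact: (X8 0%N isT).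
have sum4 (t kt u : nat) : t%:R <= X ^+ 8 -> kt%:R <= X ^+ 8 ->
    u%:R <= 48 * 16 ^+ 2 * X ^+ 8 ->
    (t + kt + u + 1)%:R <= (3 + 48 * 16 ^ 2)%:R * X ^+ 8.
  move=> ht hkt hq; rewrite [leLHS]natrD [X in X + _]natrD [X in X + _ + _]natrD.
  rewrite [in leRHS]natrD natrM natrX mulrDl addrAC lerD//.
  rewrite (_ : 3 * X ^+ 8 = X ^+ 8 + X ^+ 8 + X ^+ 8); last by ring.
  by rewrite lerD// lerD.
exact: sum4.
Qed.

Theorem theorem3 (R : realType) :
  exists (C : R)
         (A : forall (T k : nat) (rho : R), bandit_algorithm R k.+1),
    [/\ 0 < C,
        (forall (T k : nat) (rho : R), (2 <= T)%N -> 0 < rho <= 1 ->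
           replicable T (A T k rho) rho
           /\
           (forall (D : reward_dists R k.+1), supported01 D ->
            forall (d : measure_display) (Omega : measurableType d)
              (P : probability Omega R)
              (Z : input_index 1 k.+1 -> {RV P >-> R}),
              bandit_inputs D Z ->
              (expected_regret T (A T k rho) D Z <=
                (C * (k.+1%:R ^+ 2 * ln T%:R ^+ 2 / rho ^+ 2) *
                 \sum_(j < k.+1 | 0 < gap D j)
                   (gap D j + ln (k.+1%:R * T%:R * ln T%:R) / gap D j))%:E)%E))
      & polynomial_time A].
Proof.
exists (regret_constant R), (fun T k rho => elim_algorithm k T rho); split.
- by rewrite /regret_constant !mulr_gt0.
- move=> T k rho T2 rho01; split; first exact: elim_replicable.
  move=> D D01 d Omega P Z DZ.
  apply: le_trans (elim_regret T2 rho01 D01 DZ) _.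
  by rewrite lee_fin elim_regret_final.
- exact: elim_polynomial_time.
Qed.
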